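(* Let $B>0$, let $0<\alpha\le\frac12\pi$, and put $s=\sin\frac12\alpha$, $c=\cos\frac12\alpha$. Let $n\ge 1$ be a fixed integer. Let $x$ and $\rho$ be real with $0<x<B$ and $0<\rho<B$, and put $M=x^2/(4\rho)$. Then, as $M\to\infty$ (with $n<Mc^2$), $$F(x,\rho,\alpha)=-\pi e^{-\rho/2}\sum_{r=0}^\infty\frac{\rho^r}{r!}\sum_{m=0}^\infty\frac{(-1)^m(m+\tfrac12)_r}{m!}\,(\tfrac12 xs)^{2m}\,\mathcal{H}_{m+r}(xc)$$ $$\qquad+\pi e^{\rho/2}\left\{\sum_{k=0}^{n-1}\frac{M^{-k}}{2^{2k}\,k!}\,C_k(x,\alpha)+O(M^{-n})\right\}+O(e^{-Mc^2})+O(M^{-1/2}e^{-M\cos\alpha}),$$ where $$F(x,\rho,\alpha)=\int_{-\infty}^\infty\exp\left[-\tfrac12\rho\cosh(2u-i\alpha)\right]\cos(x\cosh u)\,du .$$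
   Context: Notation. $(a)_r=\Gamma(a+r)/\Gamma(a)$ is the Pochhammer symbol. The integral defining $F(x,\rho,\alpha)$ at $\alpha=\frac12\pi$, where it converges only conditionally, is understood as an improper integral. By shifting the contour $u\to u+\frac12 i\alpha$ it equals $$\int_{-\infty}^\infty e^{-\frac12\rho\cosh 2u}\cos(xc\cosh u+isx\sinh u)\,du .$$ The scaled Struve function is $$\mathcal{H}_\nu(x)=(\tfrac12 x)^{-\nu}\,\mathbf{H}_\nu(x)=\sum_{k=0}^\infty\frac{(-1)^k(\tfrac12 x)^{2k+1}}{\Gamma(k+\tfrac32)\,\Gamma(k+\nu+\tfrac32)},$$ where $\mathbf{H}_\nu$ is the Struve function. The coefficients $C_k(x,\alpha)$, for $x>0$ and integer $k\ge 0$, are $$C_k(x,\alpha)=\frac{2}{\pi}\int_0^\infty t^{2k}e^{-ct}\,\frac{\cos\left(s\sqrt{x^2+t^2}\right)}{\sqrt{x^2+t^2}}\,dt .$$ Order symbols: $\alpha$ is held fixed, and each $O(g(M))$ denotes a quantity $E=E(x,\rho)$ for which there exist constants $K>0$ and $M_0>n/c^2$, depending only on $n$, $\alpha$ and $B$, such that $|E|\le K\,g(M)$ for all $x,\rho\in(0,B)$ with $M=x^2/(4\rho)\ge M_0$. *)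

(* Defs.v *)
From Stdlib Require Import Reals Factorial.
From Coquelicot Require Import Coquelicot.
Open Scope R_scope.

Definition Cexp (z : C) : C :=
  (exp (Re z) * cos (Im z), exp (Re z) * sin (Im z)).

Definition Ccosh (z : C) : C := ((Cexp z + Cexp (- z)) / 2)%C.

(* Euler's integral, meaningful for a > 0 only; all arguments used below are
   positive.  The lower limit is improper because of the singularity at 0 when
   a < 1. *)
Definition Gamma (a : R) : R :=
  RInt_gen (fun t => Rpower t (a - 1) * exp (- t))
    (at_right 0) (Rbar_locally p_infty).

Definition pochhammer (a : R) (r : nat) : R := Gamma (a + INR r) / Gamma a.

(* (x/2)^(-nu) H_nu(x), with H_nu the Struve function. *)
Definition scaled_struve (nu x : R) : R :=
  Series (fun k : nat =>
    (-1) ^ k * (x / 2) ^ (2 * k + 1)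
    / (Gamma (INR k + 3 / 2) * Gamma (INR k + nu + 3 / 2))).

(* The two ends of the real line are approached independently, so that this
   covers the conditionally convergent case alpha = PI / 2. *)
Definition F_integrand (x rho alpha : R) (u : R) : C :=
  (Cexp (- (RtoC (rho / 2) * Ccosh (RtoC (2 * u) - Ci * RtoC alpha)))
   * RtoC (cos (x * cosh u)))%C.

Definition F (x rho alpha : R) : C :=
  RInt_gen (V := C_R_CompleteNormedModule) (F_integrand x rho alpha)
    (Rbar_locally m_infty) (Rbar_locally p_infty).

Definition coefC (k : nat) (x alpha : R) : R :=
  let s := sin (alpha / 2) in
  let c := cos (alpha / 2) in
  2 / PI *
  RInt_gen
    (fun t => t ^ (2 * k) * exp (- (c * t))
              * (cos (s * sqrt (x ^ 2 + t ^ 2)) / sqrt (x ^ 2 + t ^ 2)))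
    (at_point 0) (Rbar_locally p_infty).

Definition struve_term (x alpha : R) (r m : nat) : R :=
  let s := sin (alpha / 2) in
  let c := cos (alpha / 2) in
  (-1) ^ m * pochhammer (INR m + 1 / 2) r / INR (fact m)
  * (x * s / 2) ^ (2 * m) * scaled_struve (INR (m + r)) (x * c).

Definition Mpar (x rho : R) : R := x ^ 2 / (4 * rho).

(* E = O(g(M)) as M -> infinity, uniformly for x, rho in (0, B); the constants
   depend only on n, alpha and B. *)
Definition is_bigO (n : nat) (alpha B : R) (g : R -> R) (E : R -> R -> C)
  : Prop :=
  exists K M0 : R,
    0 < K /\ INR n / cos (alpha / 2) ^ 2 < M0 /\
    forall x rho : R,
      0 < x < B -> 0 < rho < B -> M0 <= Mpar x rho ->
      Cmod (E x rho) <= K * g (Mpar x rho).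

(* Main.v *)
(* Write [e_g(z) = exp (- rho/2 cosh 2z + i x cosh (z + i g))].  Expanding the
   cosine turns the integrand of [F] into a half sum of [e_g (u - i alpha/2)]
   with [g = alpha/2] and [g = alpha/2 + pi].  Moving the contour to the real
   axis and folding gives [F = Re (L (alpha/2) + L (- alpha/2))], where [L g] is
   the integral of [e_g] over the positive half line.  Since [e_g] has a
   primitive, the half line may be replaced by the path
   [0 -> i pi/2 -> a + i pi/2 -> +oo] with [sinh a = Y = x c / (2 rho)], whose
   last piece is the preimage under [w = cosh z] of the horizontal line through
   the saddle point [w = i Y].  The first piece is the integral form of the
   double Struve series; the second, with [t = x sinh u], is
   [int_0^{2Mc} exp (t^2/(4M) - c t) cos (s sqrt (x^2+t^2)) / sqrt (x^2+t^2) dt],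
   whose expansion in powers of [1/M] has the coefficients [C_k]; on the last
   piece [|e_g dz|] is at most a Gaussian in [Re w] of total mass
   [O(M^{-1/2} exp (- M cos alpha))]. *)

Require Import Defs.
From Stdlib Require Import Reals Factorial.
From Coquelicot Require Import Coquelicot.
From Stdlib Require Import Lra Lia Psatz.
Open Scope R_scope.

(** * Domination and improper integrals *)

(** The integrand of [F] lives on the line [Im z = - alpha / 2], and at [alpha = PI / 2] the
    convergence there is only conditional. So nothing is estimated on that line. Complex integrals
    become values of a real potential [pot], each change of path is an equality between endpoint
    values, and the vertical side linking the line to the axis is O(1/|a|), which is enough for the
    limits to agree. Bounds on a path piece come from comparing the derivative of [pot] along it
    with that of an explicit majorant.

    The constants must not depend on [x], although [1 / sqrt (x^2 + t^2)] is unbounded as [x] and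
    [t] tend to 0. One power of [t] is spent against this factor, which both the Taylor remainder
    and the tail beyond [2 M c] can afford. The Taylor expansion is under control because the second
    piece of the path stops at the stationary point [t = 2 M c] of [t^2 / (4 M) - c t]: up to there
    [t^2 / (4 M)] is at most half of [c t]. *)

Lemma derive_nonneg_le (f df : R -> R) (a b : R) :
  a <= b ->
  (forall t, a <= t <= b -> is_derive f t (df t)) ->
  (forall t, a <= t <= b -> 0 <= df t) ->
  f a <= f b.
Proof.
  intros Hab Hd Hpos.
  assert (Hm : Rmin a b = a) by (apply Rmin_left; lra).
  assert (HM : Rmax a b = b) by (apply Rmax_right; lra).
  destruct (MVT_gen f a b df) as [c [Hc Heq]]; rewrite ?Hm, ?HM in *.
  - intros t Ht; apply Hd; lra.
  - intros t Ht; apply continuity_pt_filterlim.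
    apply (ex_derive_continuous f t); exists (df t); apply Hd; lra.
  - assert (0 <= df c * (b - a)) by (apply Rmult_le_pos; [apply Hpos|]; lra).
    lra.
Qed.

(** Both [g - f] and [g + f] are nondecreasing. This takes the place of the triangle inequality for
    integrals and works directly on primitives; it yields the bounds on the vertical sides and on
    the saddle curve. *)
Lemma increment_dominated (f g df dg : R -> R) (a b : R) :
  a <= b ->
  (forall t, a <= t <= b -> is_derive f t (df t)) ->
  (forall t, a <= t <= b -> is_derive g t (dg t)) ->
  (forall t, a <= t <= b -> Rabs (df t) <= dg t) ->
  Rabs (f b - f a) <= g b - g a.
Proof.
  intros Hab Hf Hg Hle.
  assert (H1 : g a - f a <= g b - f b).
  { apply (derive_nonneg_le (fun t => g t - f t) (fun t => dg t - df t)); auto.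
    - intros t Ht; apply (is_derive_minus g f t (dg t) (df t)); auto.
    - intros t Ht; generalize (Hle t Ht) (Rle_abs (df t)); lra. }
  assert (H2 : g a + f a <= g b + f b).
  { apply (derive_nonneg_le (fun t => g t + f t) (fun t => dg t + df t)); auto.
    - intros t Ht; apply (is_derive_plus g f t (dg t) (df t)); auto.
    - intros t Ht; generalize (Hle t Ht) (Rle_abs (- df t)).
      rewrite Rabs_Ropp; lra. }
  apply Rabs_le; lra.
Qed.

(** Increments of [f] are bounded by those of the convergent [g], so [f] is Cauchy; letting the
    right end go to infinity gives the bound. One statement serves both for existence of improper
    integrals and for their tails. *)
Lemma lim_dominated (f g df dg : R -> R) (t0 l : R) :
  (forall t, t0 <= t -> is_derive f t (df t)) ->
  (forall t, t0 <= t -> is_derive g t (dg t)) ->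
  (forall t, t0 <= t -> Rabs (df t) <= dg t) ->
  is_lim g p_infty l ->
  exists l' : R, is_lim f p_infty l' /\ Rabs (l' - f t0) <= l - g t0.
Proof.
  intros Hf Hg Hle Hl.
  assert (Hinc : forall a b, t0 <= a -> a <= b ->
            Rabs (f b - f a) <= g b - g a).
  { intros a b Ha Hab.
    apply (increment_dominated f g df dg); auto; intros t Ht;
      [apply Hf | apply Hg | apply Hle]; lra. }
  destruct (proj1 (filterlim_locally_cauchy (F := Rbar_locally p_infty) f))
    as [l' Hl'].
  { intros eps.
    assert (He : 0 < eps / 2) by (destruct eps; simpl; lra).
    destruct (Hl (ball l (mkposreal _ He)) (locally_ball _ _)) as [T HT].
    exists (fun t => Rmax T t0 < t); split; [exists (Rmax T t0); auto|].
    assert (HT' : forall t, Rmax T t0 < t -> t0 <= t /\ Rabs (g t - l) < eps / 2).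
    { intros t Ht; split.
      - generalize (Rmax_r T t0); lra.
      - apply HT; generalize (Rmax_l T t0); lra. }
    assert (Hw : forall u v, u <= v -> Rmax T t0 < u -> Rabs (f v - f u) < eps).
    { intros u v Huv Hu.
      destruct (HT' u Hu) as [Hu0 Hgu]; destruct (HT' v ltac:(lra)) as [_ Hgv].
      apply Rle_lt_trans with (1 := Hinc u v Hu0 Huv).
      apply Rabs_def2 in Hgu; apply Rabs_def2 in Hgv; lra. }
    intros u v Hu Hv; change (Rabs (f v - f u) < eps).
    destruct (Rle_dec u v).
    - apply Hw; auto.
    - rewrite <- Rabs_Ropp, Ropp_minus_distr; apply Hw; auto; lra. }
  exists l'; split; [exact Hl'|].
  assert (Hf' : is_lim (fun t => Rabs (f t - f t0)) p_infty (Rabs (l' - f t0))).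
  { apply (is_lim_Rabs (fun t => f t - f t0) p_infty (l' - f t0)).
    apply (is_lim_minus f (fun _ => f t0) p_infty l' (f t0));
      [exact Hl' | apply is_lim_const | reflexivity]. }
  assert (Hg' : is_lim (fun t => g t - g t0) p_infty (l - g t0)).
  { apply (is_lim_minus g (fun _ => g t0) p_infty l (g t0));
      [exact Hl | apply is_lim_const | reflexivity]. }
  assert (Hle' : Rbar_le (Rabs (l' - f t0)) (l - g t0)).
  { apply (is_lim_le_loc (fun t => Rabs (f t - f t0)) (fun t => g t - g t0) p_infty);
      auto.
    exists t0; intros t Ht; apply Hinc; lra. }
  exact Hle'.
Qed.

(** The fundamental theorem with a limit at each end. The derivative is required only on intervals
    whose ends are far enough along both filters, so that a singular endpoint, such as 0 for the
    Gamma integrand, is allowed. *)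
Lemma is_RInt_gen_primitive (Fa Fb : (R -> Prop) -> Prop)
  {FFa : Filter Fa} {FFb : Filter Fb} (f G : R -> R) (la lb : R) :
  filter_prod Fa Fb (fun ab => forall t,
    Rmin (fst ab) (snd ab) <= t <= Rmax (fst ab) (snd ab) ->
    is_derive G t (f t) /\ continuous f t) ->
  filterlim G Fa (locally la) -> filterlim G Fb (locally lb) ->
  is_RInt_gen f Fa Fb (lb - la).
Proof.
  intros Hd Ha Hb P HP.
  assert (Hlim : filterlim (fun ab : R * R => G (snd ab) - G (fst ab))
                   (filter_prod Fa Fb) (locally (lb - la))).
  { apply (filterlim_comp_2 (F := filter_prod Fa Fb)
             (G := locally lb) (H := locally (- la))
             (fun ab => G (snd ab)) (fun ab => - G (fst ab)) Rplus).
    - apply filterlim_comp with Fb; [apply filterlim_snd | exact Hb].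
    - apply (filterlim_comp _ _ _ (fun ab : R * R => G (fst ab)) Ropp)
        with (locally la).
      + apply filterlim_comp with Fa; [apply filterlim_fst | exact Ha].
      + apply (filterlim_opp la).
    - apply (filterlim_plus lb (- la)). }
  specialize (Hlim P HP).
  unfold filtermapi; unfold filtermap in Hlim.
  generalize (filter_and _ _ Hd Hlim); apply filter_imp; intros [a b] [H1 H2].
  exists (G b - G a); split; auto; simpl in *.
  apply (is_RInt_derive G f a b); intros t Ht; apply H1; auto.
Qed.

Lemma is_RInt_gen_C (Fa Fb : (R -> Prop) -> Prop)
  {FFa : Filter Fa} {FFb : Filter Fb} (f : R -> C) (l1 l2 : R) :
  is_RInt_gen (fun t => fst (f t)) Fa Fb l1 ->
  is_RInt_gen (fun t => snd (f t)) Fa Fb l2 ->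
  is_RInt_gen (V := C_R_NormedModule) f Fa Fb (l1, l2).
Proof.
  intros H1 H2 P [eps HP].
  assert (K1 := H1 _ (locally_ball l1 eps)).
  assert (K2 := H2 _ (locally_ball l2 eps)).
  unfold filtermapi in *; generalize (filter_and _ _ K1 K2); apply filter_imp.
  intros ab [[y1 [Hy1 Hb1]] [y2 [Hy2 Hb2]]].
  exists (y1, y2); split.
  - apply (is_RInt_fct_extend_pair (U := R_NormedModule) (V := R_NormedModule));
      auto.
  - apply HP; split; auto.
Qed.

Lemma is_derive_eq (f : R -> R) (t l l' : R) :
  is_derive f t l -> l = l' -> is_derive f t l'.
Proof. intros H E; rewrite <- E; exact H. Qed.

Lemma is_derive_cosh (t : R) : is_derive cosh t (sinh t).
Proof. apply is_derive_Reals, derivable_pt_lim_cosh. Qed.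

Lemma is_derive_sinh (t : R) : is_derive sinh t (cosh t).
Proof. apply is_derive_Reals, derivable_pt_lim_sinh. Qed.

Lemma exp_mult_opp (t : R) : exp t * exp (- t) = 1.
Proof.
  rewrite <- exp_plus; replace (t + - t) with 0 by ring; apply exp_0.
Qed.

Lemma cosh2_sinh2 (t : R) : cosh t ^ 2 - sinh t ^ 2 = 1.
Proof. rewrite <- (exp_mult_opp t); unfold cosh, sinh; field. Qed.

Lemma cosh_double (t : R) : cosh (2 * t) = 1 + 2 * sinh t ^ 2.
Proof.
  rewrite <- (exp_mult_opp t); unfold cosh, sinh.
  replace (2 * t) with (t + t) by ring; replace (- (t + t)) with (- t + - t) by ring.
  rewrite !exp_plus; field.
Qed.

Lemma cosh_ge_1 (t : R) : 1 <= cosh t.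
Proof.
  assert (0 < cosh t).
  { unfold cosh; generalize (exp_pos t) (exp_pos (- t)); lra. }
  generalize (cosh2_sinh2 t) (pow2_ge_0 (sinh t)); nra.
Qed.

Lemma sinh_ge (t : R) : 0 <= t -> t <= sinh t.
Proof.
  intros Ht.
  enough (sinh 0 - 0 <= sinh t - t) by (rewrite sinh_0 in *; lra).
  apply (derive_nonneg_le (fun u => sinh u - u) (fun u => cosh u - 1)); auto.
  - intros u _; apply (is_derive_minus sinh (fun u => u) u (cosh u) 1).
    + apply is_derive_sinh.
    + apply (is_derive_id u).
  - intros u _; generalize (cosh_ge_1 u); lra.
Qed.

Lemma sinh_opp (t : R) : sinh (- t) = - sinh t.
Proof. unfold sinh; rewrite Ropp_involutive; field. Qed.

Lemma cosh_opp (t : R) : cosh (- t) = cosh t.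
Proof. unfold cosh; rewrite Ropp_involutive; field. Qed.

Lemma Rabs_sinh_ge (t : R) : Rabs t <= Rabs (sinh t).
Proof.
  destruct (Rle_dec 0 t) as [Ht|Ht].
  - generalize (sinh_ge t Ht); intros; rewrite !Rabs_pos_eq; lra.
  - generalize (sinh_ge (- t) ltac:(lra)); rewrite sinh_opp; intros.
    rewrite !Rabs_left1; lra.
Qed.

(** * The kernel and its potential *)

(** With [phase_im], the real and imaginary parts of the exponent of [e_g] at [z = a + i b], from
    cosh(p + i q) = cosh p cos q + i sinh p sin q. *)
Definition phase_re (r x g a b : R) : R :=
  - (r / 2) * (cosh (2 * a) * cos (2 * b)) - x * (sinh a * sin (b + g)).

Definition phase_im (r x g a b : R) : R :=
  - (r / 2) * (sinh (2 * a) * sin (2 * b)) + x * (cosh a * cos (b + g)).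

(* [ker_re + i ker_im] is [exp (i d) e_g (a + i b)], with [r] for [rho]; the
   phase [d] gives access to both the real ([d = 0]) and the imaginary
   ([d = - PI / 2]) part of [e_g]. *)
Definition ker_re (r x g d a b : R) : R :=
  exp (phase_re r x g a b) * cos (phase_im r x g a b + d).

Definition ker_im (r x g d a b : R) : R :=
  exp (phase_re r x g a b) * sin (phase_im r x g a b + d).

(** Only derivatives in [a] get names: the exponent is holomorphic, so Cauchy-Riemann expresses the
    derivatives in [b] through them. *)
Definition phase_re_da (r x g a b : R) : R :=
  - r * (sinh (2 * a) * cos (2 * b)) - x * (cosh a * sin (b + g)).

Definition phase_im_da (r x g a b : R) : R :=
  - r * (cosh (2 * a) * sin (2 * b)) + x * (sinh a * cos (b + g)).

Definition ker_im_da (r x g d a b : R) : R :=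
  exp (phase_re r x g a b) *
  (phase_re_da r x g a b * sin (phase_im r x g a b + d)
   + phase_im_da r x g a b * cos (phase_im r x g a b + d)).

Lemma is_derive_phase_re_a (r x g a b : R) :
  is_derive (fun a => phase_re r x g a b) a (phase_re_da r x g a b).
Proof.
  unfold phase_re, phase_re_da, cosh, sinh; auto_derive; [auto|].
  field.
Qed.

Lemma is_derive_phase_im_a (r x g a b : R) :
  is_derive (fun a => phase_im r x g a b) a (phase_im_da r x g a b).
Proof.
  unfold phase_im, phase_im_da, cosh, sinh; auto_derive; [auto|].
  field.
Qed.

Lemma is_derive_phase_re_b (r x g a b : R) :
  is_derive (fun b => phase_re r x g a b) b (- phase_im_da r x g a b).
Proof. unfold phase_re, phase_im_da; auto_derive; [auto|field]. Qed.

Lemma is_derive_phase_im_b (r x g a b : R) :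
  is_derive (fun b => phase_im r x g a b) b (phase_re_da r x g a b).
Proof. unfold phase_im, phase_re_da; auto_derive; [auto|field]. Qed.

Lemma is_derive_exp_sin (p q : R -> R) (dp dq d t : R) :
  is_derive p t dp -> is_derive q t dq ->
  is_derive (fun t => exp (p t) * sin (q t + d)) t
    (exp (p t) * (dp * sin (q t + d) + dq * cos (q t + d))).
Proof.
  intros Hp Hq; auto_derive.
  - repeat split; eexists; eassumption.
  - rewrite (is_derive_unique (fun t : R => p t) t dp Hp).
    rewrite (is_derive_unique (fun t : R => q t) t dq Hq); ring.
Qed.

Lemma is_derive_exp_cos (p q : R -> R) (dp dq d t : R) :
  is_derive p t dp -> is_derive q t dq ->
  is_derive (fun t => exp (p t) * cos (q t + d)) t
    (exp (p t) * (dp * cos (q t + d) - dq * sin (q t + d))).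
Proof.
  intros Hp Hq; auto_derive.
  - repeat split; eexists; eassumption.
  - rewrite (is_derive_unique (fun t : R => p t) t dp Hp).
    rewrite (is_derive_unique (fun t : R => q t) t dq Hq); ring.
Qed.

Lemma is_derive_ker_im_a (r x g d a b : R) :
  is_derive (fun a => ker_im r x g d a b) a (ker_im_da r x g d a b).
Proof.
  apply (is_derive_exp_sin (fun a => phase_re r x g a b)
           (fun a => phase_im r x g a b)).
  - apply is_derive_phase_re_a.
  - apply is_derive_phase_im_a.
Qed.

(* This and the previous lemma are the Cauchy-Riemann equation that makes the
   form [ker_re da - ker_im db] closed. *)
Lemma is_derive_ker_re_b (r x g d a b : R) :
  is_derive (fun b => ker_re r x g d a b) b (- ker_im_da r x g d a b).
Proof.
  replace (- ker_im_da r x g d a b) with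
    (exp (phase_re r x g a b) *
     (- phase_im_da r x g a b * cos (phase_im r x g a b + d)
      - phase_re_da r x g a b * sin (phase_im r x g a b + d)))
    by (unfold ker_im_da; ring).
  apply (is_derive_exp_cos (phase_re r x g a) (phase_im r x g a)).
  - apply is_derive_phase_re_b.
  - apply is_derive_phase_im_b.
Qed.

Ltac cont2d :=
  repeat first
    [ apply continuity_2d_pt_const
    | apply continuity_2d_pt_id1
    | apply continuity_2d_pt_id2
    | apply (continuity_1d_2d_pt_comp exp);
        [apply derivable_continuous_pt, derivable_pt_exp|]
    | apply (continuity_1d_2d_pt_comp sin); [apply continuity_sin|]
    | apply (continuity_1d_2d_pt_comp cos); [apply continuity_cos|]
    | apply (continuity_1d_2d_pt_comp sinh);
        [apply derivable_continuous_pt, derivable_pt_sinh|]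
    | apply (continuity_1d_2d_pt_comp cosh);
        [apply derivable_continuous_pt, derivable_pt_cosh|]
    | apply continuity_2d_pt_mult
    | apply continuity_2d_pt_minus
    | apply continuity_2d_pt_plus ].

Lemma continuity_2d_ker_re (r x g d a b : R) :
  continuity_2d_pt (ker_re r x g d) a b.
Proof. unfold ker_re, phase_re, phase_im; cont2d. Qed.

Lemma continuity_2d_ker_im (r x g d a b : R) :
  continuity_2d_pt (ker_im r x g d) a b.
Proof. unfold ker_im, phase_re, phase_im; cont2d. Qed.

Lemma continuity_2d_ker_im_da (r x g d a b : R) :
  continuity_2d_pt (ker_im_da r x g d) a b.
Proof.
  unfold ker_im_da, phase_re, phase_im, phase_re_da, phase_im_da; cont2d.
Qed.

Lemma continuity_2d_continuous_1 (f : R -> R -> R) (a b : R) :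
  continuity_2d_pt f a b -> continuous (fun u => f u b) a.
Proof.
  intros H; apply continuity_pt_filterlim.
  intros eps He; destruct (H (mkposreal eps He)) as [dl Hd].
  exists dl; split; [apply dl|].
  intros u [_ Hu]; apply Hd; [exact Hu|].
  rewrite Rminus_diag, Rabs_R0; apply dl.
Qed.

Lemma continuity_2d_continuous_2 (f : R -> R -> R) (a b : R) :
  continuity_2d_pt f a b -> continuous (fun v => f a v) b.
Proof.
  intros H; apply continuity_pt_filterlim.
  intros eps He; destruct (H (mkposreal eps He)) as [dl Hd].
  exists dl; split; [apply dl|].
  intros u [_ Hu]; apply Hd; [|exact Hu].
  rewrite Rminus_diag, Rabs_R0; apply dl.
Qed.

Lemma is_derive_RInt_upper (f : R -> R) (t : R) :
  (forall u, continuous f u) -> is_derive (fun s => RInt f 0 s) t (f t).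
Proof.
  intros Hf; apply (is_derive_RInt f (fun s => RInt f 0 s) 0 t).
  - apply filter_forall; intros s.
    apply (RInt_correct f), (ex_RInt_continuous f); auto.
  - apply Hf.
Qed.

(* The real part of the primitive of [exp (i d) e_g] vanishing at 0. *)
Definition pot (r x g d a b : R) : R :=
  RInt (fun u => ker_re r x g d u 0) 0 a - RInt (fun v => ker_im r x g d a v) 0 b.

Lemma is_derive_pot_b (r x g d a b : R) :
  is_derive (fun b => pot r x g d a b) b (- ker_im r x g d a b).
Proof.
  unfold pot.
  replace (- ker_im r x g d a b) with (0 - ker_im r x g d a b) by ring.
  apply (is_derive_minus (fun _ => _) (fun b => RInt (ker_im r x g d a) 0 b) b
           0 (ker_im r x g d a b)).
  - apply (is_derive_const (V := R_NormedModule)).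
  - apply (is_derive_RInt_upper (ker_im r x g d a)).
    intros v; apply continuity_2d_continuous_2, continuity_2d_ker_im.
Qed.

(** This is where closedness of the form enters: [pot] integrates along the axis and then
    vertically, yet moving its endpoint horizontally sees only the kernel at that endpoint. *)
Lemma is_derive_pot_a (r x g d a b : R) :
  is_derive (fun a => pot r x g d a b) a (ker_re r x g d a b).
Proof.
  unfold pot.
  replace (ker_re r x g d a b) with
    (ker_re r x g d a 0 - RInt (fun v => ker_im_da r x g d a v) 0 b).
  - apply (is_derive_minus (fun a => RInt (fun u => ker_re r x g d u 0) 0 a)
             (fun a => RInt (fun v => ker_im r x g d a v) 0 b)).
    + apply (is_derive_RInt_upper (fun u => ker_re r x g d u 0)).
      intros u; apply (continuity_2d_continuous_1 (ker_re r x g d)).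
      apply continuity_2d_ker_re.
    + rewrite (RInt_ext (fun v => ker_im_da r x g d a v)
                 (fun v => Derive (fun u => ker_im r x g d u v) a)).
      2:{ intros v _; symmetry; apply is_derive_unique, is_derive_ker_im_a. }
      apply (is_derive_RInt_param (fun u v => ker_im r x g d u v) 0 b a).
      * apply filter_forall; intros u v _; eexists; apply is_derive_ker_im_a.
      * intros v _.
        apply continuity_2d_pt_ext with (ker_im_da r x g d).
        -- intros p q; symmetry; apply is_derive_unique, is_derive_ker_im_a.
        -- apply continuity_2d_ker_im_da.
      * apply filter_forall; intros u; apply (ex_RInt_continuous (ker_im r x g d u)).
        intros v _; apply continuity_2d_continuous_2, continuity_2d_ker_im.
  (* By Cauchy-Riemann the vertical integral of [ker_im_da] telescopes, exchanging the kernel on the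
     axis for the kernel at height [b]. *)
  - enough (H : is_RInt (fun v => ker_im_da r x g d a v) 0 b
              (- ker_re r x g d a b - - ker_re r x g d a 0)).
    { rewrite (is_RInt_unique _ _ _ _ H); ring. }
    apply (is_RInt_derive (fun v => - ker_re r x g d a v)).
    + intros v _; rewrite <- (Ropp_involutive (ker_im_da r x g d a v)).
      apply (is_derive_opp (fun v => ker_re r x g d a v)), is_derive_ker_re_b.
    + intros v _; apply continuity_2d_continuous_2, continuity_2d_ker_im_da.
Qed.

(** The chain rule along the saddle curve needs a total derivative; two partial derivatives, one of
    them continuous, provide it. *)
Lemma differentiable_pot (r x g d a b : R) :
  differentiable_pt_lim (pot r x g d) a b (ker_re r x g d a b) (- ker_im r x g d a b).
Proof.
  apply filterdiff_differentiable_pt_lim.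
  apply (is_derive_filterdiff (pot r x g d) a b (ker_re r x g d)).
  - apply filter_forall; intros [u v]; apply is_derive_pot_a.
  - apply is_derive_pot_b.
  - apply continuity_2d_pt_filterlim, continuity_2d_ker_re.
Qed.

(** * Behaviour at infinity *)

Lemma Rabs_ker_re_le (r x g d a b : R) :
  Rabs (ker_re r x g d a b) <= exp (phase_re r x g a b).
Proof.
  unfold ker_re; rewrite Rabs_mult, (Rabs_pos_eq (exp _)); [|left; apply exp_pos].
  rewrite <- (Rmult_1_r (exp _)) at 2.
  apply Rmult_le_compat_l; [left; apply exp_pos|].
  apply Rabs_le, COS_bound.
Qed.

Lemma Rabs_ker_im_le (r x g d a b : R) :
  Rabs (ker_im r x g d a b) <= exp (phase_re r x g a b).
Proof.
  unfold ker_im; rewrite Rabs_mult, (Rabs_pos_eq (exp _)); [|left; apply exp_pos].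
  rewrite <- (Rmult_1_r (exp _)) at 2.
  apply Rmult_le_compat_l; [left; apply exp_pos|].
  apply Rabs_le, SIN_bound.
Qed.

Lemma exp_le_compat (a b : R) : a <= b -> exp a <= exp b.
Proof. intros [H|H]; [left; apply exp_increasing; auto | rewrite H; lra]. Qed.

Lemma Rabs_sin_le_1 (t : R) : Rabs (sin t) <= 1.
Proof. apply Rabs_le, SIN_bound. Qed.

(** Complete the square in |sinh u| with slope [x + 1] in place of [x]: the extra unit leaves a
    spare -|sinh u|, which is at most -|u|. *)
Lemma phase_decay (r x u : R) : 0 < r ->
  - (r / 2) * cosh (2 * u) + x * Rabs (sinh u) <= (x + 1) ^ 2 / (4 * r) - Rabs u.
Proof.
  intros Hr; rewrite cosh_double, <- (pow2_abs (sinh u)).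
  generalize (Rabs_sinh_ge u); set (S := Rabs (sinh u)); intros HS.
  assert (0 <= r * (S - (x + 1) / (2 * r)) ^ 2)
    by (apply Rmult_le_pos; [lra | apply pow2_ge_0]).
  replace (r * (S - (x + 1) / (2 * r)) ^ 2) with
    (r * S ^ 2 - (x + 1) * S + (x + 1) ^ 2 / (4 * r)) in H by (field; lra).
  lra.
Qed.

(** Decay in [a] persists wherever cos 2b stays above a positive [k]: it is used with 1 on the axis
    and with 1/2 for heights up to [PI / 6]. *)
Lemma phase_re_le (r x g a b k : R) : 0 <= r -> 0 <= x ->
  k <= cos (2 * b) ->
  phase_re r x g a b <= - (r * k / 2) * cosh (2 * a) + x * Rabs (sinh a).
Proof.
  intros Hr Hx Hk; unfold phase_re.
  assert (H1 : r / 2 * cosh (2 * a) * k <= r / 2 * cosh (2 * a) * cos (2 * b)).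
  { apply Rmult_le_compat_l; auto.
    apply Rmult_le_pos; [lra|]; generalize (cosh_ge_1 (2 * a)); lra. }
  assert (H2 : - (sinh a * sin (b + g)) <= Rabs (sinh a)).
  { apply Rle_trans with (Rabs (- (sinh a * sin (b + g)))); [apply Rle_abs|].
    rewrite Rabs_Ropp, Rabs_mult.
    rewrite <- (Rmult_1_r (Rabs (sinh a))) at 2.
    apply Rmult_le_compat_l; [apply Rabs_pos | apply Rabs_sin_le_1]. }
  apply (Rmult_le_compat_l x) in H2; auto; lra.
Qed.

Lemma is_lim_exp_opp (k c : R) : 0 < c ->
  is_lim (fun t => k * exp (- (c * t))) p_infty 0.
Proof.
  intros Hc; replace (Finite 0) with (Rbar_mult k 0)
    by (simpl; f_equal; ring).
  apply (is_lim_scal_l (fun t => exp (- (c * t))) k p_infty 0).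
  apply (is_lim_comp exp (fun t => - (c * t)) p_infty 0 m_infty).
  - apply is_lim_exp_m.
  - replace m_infty with (Rbar_opp p_infty) by reflexivity.
    apply (is_lim_opp (fun t => c * t) p_infty p_infty).
    replace p_infty with (Rbar_mult c p_infty) at 2.
    + apply (is_lim_scal_l (fun t => t)), is_lim_id.
    + simpl; destruct (Rle_dec 0 c) as [H|H]; [|lra].
      destruct (Rle_lt_or_eq_dec 0 c H); [reflexivity|lra].
  - exists 0; intros; discriminate.
Qed.

Lemma ex_lim_pot (r x g d : R) : 0 < r -> 0 <= x ->
  ex_finite_lim (fun t => pot r x g d t 0) p_infty.
Proof.
  intros Hr Hx.
  set (K := exp ((x + 1) ^ 2 / (4 * r))).
  destruct (lim_dominated (fun t => pot r x g d t 0) (fun t => (- K) * exp (- (1 * t)))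
    (fun t => ker_re r x g d t 0) (fun t => K * exp (- t)) 0 0) as [l [Hl _]].
  - intros t _; apply is_derive_pot_a.
  - intros t _; auto_derive; auto.
    rewrite (Rmult_1_l t); ring.
  - intros t Ht; apply Rle_trans with (1 := Rabs_ker_re_le _ _ _ _ _ _).
    unfold K; rewrite <- exp_plus; apply exp_le_compat.
    apply Rle_trans with (1 := phase_re_le r x g t 0 1 ltac:(lra) Hx
                                 ltac:(rewrite Rmult_0_r, cos_0; lra)).
    generalize (phase_decay r x t Hr); rewrite (Rabs_pos_eq t Ht).
    rewrite Rmult_1_r; lra.
  - apply is_lim_exp_opp; lra.
  - exists l; exact Hl.
Qed.

(** The real part of exp(i d) L(g), with L as in the overview. By [ex_lim_pot] the limit is finite
    for [0 < r] and [0 <= x], so [real] does not fall back on its default there. *)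
Definition pot_lim (r x g d : R) : R := real (Lim (fun t => pot r x g d t 0) p_infty).

Lemma is_lim_pot (r x g d : R) : 0 < r -> 0 <= x ->
  is_lim (fun t => pot r x g d t 0) p_infty (pot_lim r x g d).
Proof. intros Hr Hx; apply Lim_correct', ex_lim_pot; auto. Qed.

Lemma pot_axis (r x g d a : R) :
  pot r x g d a 0 = RInt (fun u => ker_re r x g d u 0) 0 a.
Proof.
  unfold pot; rewrite RInt_point; unfold zero; simpl; ring.
Qed.

(** The substitution u -> -u changes the sign of sinh u, which on the real axis amounts to changing
    the sign of [g]. This folds the left half line onto the right one. *)
Lemma pot_axis_opp (r x g d a : R) : pot r x g d (- a) 0 = - pot r x (- g) d a 0.
Proof.
  rewrite !pot_axis.
  assert (H : is_RInt (fun y => scal (-1) (ker_re r x g d (- y) 0)) 0 a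
                (RInt (fun u => ker_re r x g d u 0) (- 0) (- a))).
  { apply (is_RInt_comp (fun u => ker_re r x g d u 0) (fun y => - y) (fun _ => -1)).
    - intros u _; apply (continuity_2d_continuous_1 (ker_re r x g d)).
      apply continuity_2d_ker_re.
    - intros u _; split; [auto_derive; auto; ring | apply continuous_const]. }
  rewrite Ropp_0 in H; rewrite <- (is_RInt_unique _ _ _ _ H).
  rewrite <- (RInt_opp (fun u => ker_re r x (- g) d u 0)).
  2:{ apply (ex_RInt_continuous (fun u => ker_re r x (- g) d u 0)).
      intros u _; apply (continuity_2d_continuous_1 (ker_re r x (- g) d)).
      apply continuity_2d_ker_re. }
  apply RInt_ext; intros u _.
  unfold ker_re, phase_re, phase_im, scal, opp; simpl; unfold mult; simpl.
  replace (2 * - u) with (- (2 * u)) by ring.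
  rewrite !sinh_opp, !cosh_opp, !Rplus_0_l, sin_neg, cos_neg, Rmult_0_r, sin_0.
  replace (- sinh u * sin g) with (sinh u * - sin g) by ring.
  rewrite !Rmult_0_r; ring.
Qed.

(** Under these hypotheses [e_h] is the complex conjugate of [e_g] on the real axis, so conjugation
    moves the sign to the phase [d]. It applies to [g] and [PI - g], modulo full turns. *)
Lemma pot_axis_conj (r x g h d a : R) : sin h = sin g -> cos h = - cos g ->
  pot r x h d a 0 = pot r x g (- d) a 0.
Proof.
  intros Hs Hc; rewrite !pot_axis; apply RInt_ext; intros u _.
  unfold ker_re, phase_re, phase_im.
  rewrite !Rplus_0_l, Hs, Hc, Rmult_0_r, sin_0, !Rmult_0_r.
  match goal with |- _ * cos ?p = _ => rewrite <- (cos_neg p) end.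
  f_equal; f_equal; ring.
Qed.

Lemma pot_axis_d_opp (r x g a : R) :
  pot r x g (PI / 2) a 0 = - pot r x g (- (PI / 2)) a 0.
Proof.
  rewrite !pot_axis, <- (RInt_opp (fun u => ker_re r x g (- (PI / 2)) u 0)).
  2:{ apply (ex_RInt_continuous (fun u => ker_re r x g (- (PI / 2)) u 0)).
      intros u _; apply (continuity_2d_continuous_1 (ker_re r x g (- (PI / 2)))).
      apply continuity_2d_ker_re. }
  apply RInt_ext; intros u _; unfold ker_re, opp; simpl.
  replace (phase_im r x g u 0 + PI / 2) with
    (phase_im r x g u 0 + - (PI / 2) + PI) by field.
  rewrite neg_cos; ring.
Qed.

Lemma sin_ge_half (b : R) : 0 <= b <= PI / 4 -> b / 2 <= sin b.
Proof.
  intros Hb; generalize PI_RGT_0; intros HPI.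
  enough (sin 0 - 0 / 2 <= sin b - b / 2) by (rewrite sin_0 in *; lra).
  apply (derive_nonneg_le (fun b => sin b - b / 2) (fun b => cos b - 1 / 2)); [lra| |].
  - intros t _; auto_derive; auto; field.
  - intros t Ht; rewrite <- cos_PI3.
    enough (cos (PI / 3) <= cos t) by lra.
    apply cos_decr_1; lra.
Qed.

(** Put theta = b + al/2. Both cos 2b and |sin(b + g)| are comparable with sin theta, from below and
    exactly, so sin theta factors out of the bound, and it is at least theta/2. The bound
    degenerates at theta = 0, as it must: for [al = PI / 2] the kernel has modulus 1 on that edge
    when sin(b + g) = 0. *)
Lemma phase_re_strip (r x al g a b : R) :
  0 < r -> 0 <= x -> 0 < al <= PI / 2 ->
  Rabs (sin (b + g)) = Rabs (sin (b + al / 2)) ->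
  - (al / 2) <= b <= 0 ->
  0 <= r / 2 * cosh (2 * a) - x * Rabs (sinh a) ->
  phase_re r x g a b <=
    - ((b + al / 2) / 2 * (r / 2 * cosh (2 * a) - x * Rabs (sinh a))).
Proof.
  intros Hr Hx Hal Hg Hb HN.
  generalize PI_RGT_0; intros HPI.
  assert (Hs := sin_ge_half (b + al / 2) ltac:(lra)).
  (* Since [al <= PI / 2], the angle -2b is at most PI/2 - 2 theta, whose cosine is sin 2 theta = 2
     sin theta cos theta; and cos theta is at least 1/2. *)
  assert (Hcos : sin (b + al / 2) <= cos (2 * b)).
  { rewrite <- (cos_neg (2 * b)).
    apply Rle_trans with (cos (PI / 2 - 2 * (b + al / 2))).
    - rewrite cos_shift, sin_2a.
      assert (1 / 2 <= cos (b + al / 2))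
        by (rewrite <- cos_PI3; apply cos_decr_1; lra).
      nra.
    - apply cos_decr_1; lra. }
  rewrite (Rabs_pos_eq (sin (b + al / 2))) in Hg by lra.
  unfold phase_re.
  assert (H1 : r / 2 * cosh (2 * a) * sin (b + al / 2)
               <= r / 2 * cosh (2 * a) * cos (2 * b)).
  { apply Rmult_le_compat_l; auto.
    apply Rmult_le_pos; [lra|]; generalize (cosh_ge_1 (2 * a)); lra. }
  assert (H2 : - (sinh a * sin (b + g)) <= Rabs (sinh a) * sin (b + al / 2)).
  { apply Rle_trans with (Rabs (- (sinh a * sin (b + g)))); [apply Rle_abs|].
    rewrite Rabs_Ropp, Rabs_mult, Hg; lra. }
  apply (Rmult_le_compat_l x) in H2; auto.
  assert (H3 := Rmult_le_compat_r _ _ _ HN Hs); lra.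
Qed.

(** By [phase_re_strip] and [phase_decay] the kernel is at most exp(- theta N / 2), where theta = b
    + al/2 and N is the denominator on the right; integrating over theta >= 0 gives 2/N. Decay in
    [a] is only algebraic because the lower edge of the strip contributes without damping when
    [al = PI / 2]. *)
Lemma pot_vertical_side (r x al g d a : R) :
  0 < r -> 0 <= x -> 0 < al <= PI / 2 ->
  (forall b, Rabs (sin (b + g)) = Rabs (sin (b + al / 2))) ->
  (x + 1) ^ 2 / (4 * r) < Rabs a ->
  Rabs (pot r x g d a 0 - pot r x g d a (- (al / 2)))
    <= 2 / (Rabs a - (x + 1) ^ 2 / (4 * r)).
Proof.
  intros Hr Hx Hal Hg Ha.
  set (N := Rabs a - (x + 1) ^ 2 / (4 * r)).
  assert (HN : 0 < N) by (unfold N; lra).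
  assert (HN' := phase_decay r x a Hr).
  apply Rle_trans with
    (- (2 / N) * exp (- ((0 + al / 2) / 2 * N))
     - (- (2 / N) * exp (- ((- (al / 2) + al / 2) / 2 * N)))).
  - apply (increment_dominated (pot r x g d a)
      (fun b => - (2 / N) * exp (- ((b + al / 2) / 2 * N)))
      (fun b => - ker_im r x g d a b)
      (fun b => exp (- ((b + al / 2) / 2 * N)))); [lra| | |].
    + intros b _; apply is_derive_pot_b.
    + intros b _; auto_derive; auto.
      change ((b + al / 2) * / 2 * N) with ((b + al / 2) / 2 * N); field; lra.
    + intros b Hb; rewrite Rabs_Ropp.
      apply Rle_trans with (1 := Rabs_ker_im_le _ _ _ _ _ _), exp_le_compat.
      apply Rle_trans with
        (1 := phase_re_strip r x al g a b Hr Hx Hal (Hg b) Hb ltac:(lra)).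
      apply Ropp_le_contravar, Rmult_le_compat_l; [lra|].
      unfold N; lra.
  - replace (- (al / 2) + al / 2) with 0 by ring.
    replace (- (0 / 2 * N)) with 0 by field; rewrite exp_0.
    assert (0 <= 2 / N * exp (- ((0 + al / 2) / 2 * N))).
    { apply Rmult_le_pos; [|left; apply exp_pos].
      unfold Rdiv; apply Rmult_le_pos; [lra | left; apply Rinv_0_lt_compat; auto]. }
    lra.
Qed.

Lemma vanish_of_inverse_bound (f : R -> R) (K : R) :
  (forall t, K < t -> Rabs (f t) <= 2 / (t - K)) -> is_lim f p_infty 0.
Proof.
  intros Hf; apply is_lim_spec; intros eps.
  assert (He := cond_pos eps).
  exists (K + 2 / eps); intros t Ht; rewrite Rminus_0_r.
  assert (0 < 2 / eps) by (apply Rdiv_lt_0_compat; lra).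
  apply Rle_lt_trans with (1 := Hf t ltac:(lra)).
  apply Rmult_lt_reg_r with (t - K); [lra|].
  unfold Rdiv; rewrite Rmult_assoc, Rinv_l, Rmult_1_r by lra.
  apply Rmult_lt_reg_l with (/ eps); [apply Rinv_0_lt_compat; auto|].
  rewrite <- Rmult_assoc, Rinv_l, Rmult_1_l by lra.
  unfold Rdiv in Ht; lra.
Qed.

Lemma is_lim_pot_shift_p (r x al g d : R) :
  0 < r -> 0 <= x -> 0 < al <= PI / 2 ->
  (forall b, Rabs (sin (b + g)) = Rabs (sin (b + al / 2))) ->
  is_lim (fun t => pot r x g d t (- (al / 2))) p_infty (pot_lim r x g d).
Proof.
  intros Hr Hx Hal Hg.
  apply (is_lim_ext (fun t => pot r x g d t 0 -
           (pot r x g d t 0 - pot r x g d t (- (al / 2))))); [intros; ring|].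
  replace (Finite (pot_lim r x g d)) with (Finite (pot_lim r x g d - 0))
    by (f_equal; ring).
  apply (is_lim_minus (fun t => pot r x g d t 0) _ p_infty (pot_lim r x g d) 0).
  - apply is_lim_pot; auto.
  - apply vanish_of_inverse_bound with ((x + 1) ^ 2 / (4 * r)); intros t Ht.
    assert (0 <= (x + 1) ^ 2 / (4 * r)).
    { apply Rmult_le_pos; [apply pow2_ge_0|]; left; apply Rinv_0_lt_compat; lra. }
    assert (Rabs t = t) by (apply Rabs_pos_eq; lra).
    rewrite <- H0 at 3; apply pot_vertical_side; auto; lra.
  - reflexivity.
Qed.

(** The axis part is reflected by [pot_axis_opp]; the vertical side is bounded directly, since its
    estimate depends on |a| only. *)
Lemma is_lim_pot_shift_m (r x al g d : R) :
  0 < r -> 0 <= x -> 0 < al <= PI / 2 ->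
  (forall b, Rabs (sin (b + g)) = Rabs (sin (b + al / 2))) ->
  is_lim (fun t => pot r x g d t (- (al / 2))) m_infty (- pot_lim r x (- g) d).
Proof.
  intros Hr Hx Hal Hg.
  apply (is_lim_ext (fun t => (fun s => pot r x g d (- s) (- (al / 2))) (- t)));
    [intros t; rewrite Ropp_involutive; auto|].
  apply (is_lim_comp (fun s => pot r x g d (- s) (- (al / 2))) (fun t => - t)
           m_infty _ p_infty).
  - apply (is_lim_ext (fun t => - pot r x (- g) d t 0 -
           (pot r x g d (- t) 0 - pot r x g d (- t) (- (al / 2)))));
      [intros; rewrite pot_axis_opp; ring|].
    replace (Finite (- pot_lim r x (- g) d)) with (Finite (- pot_lim r x (- g) d - 0))
      by (f_equal; ring).
    apply (is_lim_minus (fun t => - pot r x (- g) d t 0) _ p_infty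
             (- pot_lim r x (- g) d) 0).
    + apply (is_lim_opp (fun t => pot r x (- g) d t 0) p_infty (pot_lim r x (- g) d)).
      apply is_lim_pot; auto.
    + apply vanish_of_inverse_bound with ((x + 1) ^ 2 / (4 * r)); intros t Ht.
      assert (0 <= (x + 1) ^ 2 / (4 * r)).
      { apply Rmult_le_pos; [apply pow2_ge_0|]; left; apply Rinv_0_lt_compat; lra. }
      assert (Rabs (- t) = t) by (rewrite Rabs_Ropp; apply Rabs_pos_eq; lra).
      rewrite <- H0 at 3; apply pot_vertical_side; auto; lra.
    + reflexivity.
  - apply (is_lim_opp (fun t => t) m_infty m_infty), is_lim_id.
  - exists 0; intros; discriminate.
Qed.

(** * The integral F *)

Lemma cos_sum_product (p q : R) : cos (q + p) + cos (q - p) = 2 * (cos q * cos p).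
Proof. rewrite cos_plus, cos_minus; ring. Qed.

Lemma sin_sum_product (p q : R) : sin (q + p) + sin (q - p) = 2 * (sin q * cos p).
Proof. rewrite sin_plus, sin_minus; ring. Qed.

Lemma F_integrand_eq (x rho alpha u : R) :
  F_integrand x rho alpha u =
    (exp (- (rho / 2) * (cosh (2 * u) * cos alpha))
       * cos (rho / 2 * (sinh (2 * u) * sin alpha)) * cos (x * cosh u),
     exp (- (rho / 2) * (cosh (2 * u) * cos alpha))
       * sin (rho / 2 * (sinh (2 * u) * sin alpha)) * cos (x * cosh u)).
Proof.
  assert (H : (- (RtoC (rho / 2) * Ccosh (RtoC (2 * u) - Ci * RtoC alpha)))%C =
    (- (rho / 2) * (cosh (2 * u) * cos alpha), rho / 2 * (sinh (2 * u) * sin alpha))).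
  { unfold Ccosh, Cexp, cosh, sinh, Cdiv, Cinv, Cminus, Cplus, Copp, Cmult, RtoC, Ci, Re, Im;
      simpl.
    replace (2 * u + - (0 * alpha - 1 * 0)) with (2 * u) by ring.
    replace (0 + - (0 * 0 + 1 * alpha)) with (- alpha) by ring.
    rewrite Ropp_involutive, cos_neg, sin_neg; f_equal; field. }
  unfold F_integrand; rewrite H.
  unfold Cexp, Cmult, RtoC, Re, Im; simpl; f_equal; ring.
Qed.

Lemma phase_re_shift (r x al u g : R) : sin (- (al / 2) + g) = 0 ->
  phase_re r x g u (- (al / 2)) = - (r / 2) * (cosh (2 * u) * cos al).
Proof.
  intros H; unfold phase_re; rewrite H.
  replace (2 * - (al / 2)) with (- al) by field; rewrite cos_neg; ring.
Qed.

Lemma phase_im_shift (r x al u g : R) :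
  phase_im r x g u (- (al / 2))
  = r / 2 * (sinh (2 * u) * sin al) + x * (cosh u * cos (- (al / 2) + g)).
Proof.
  unfold phase_im.
  replace (2 * - (al / 2)) with (- al) by field; rewrite sin_neg; ring.
Qed.

(** For both values of [g] the height -al/2 makes sin(b + g) vanish, so [x] leaves the real phase,
    and cos(b + g) is 1 or -1. Averaging the two signs of x cosh u rebuilds the factor cos(x cosh
    u). The choices [d = 0] and [d = - PI / 2] give the real and imaginary parts of the
    integrand. *)
Lemma ker_re_shift_sum (r x al d u : R) :
  / 2 * (ker_re r x (al / 2) d u (- (al / 2))
         + ker_re r x (al / 2 + PI) d u (- (al / 2)))
  = exp (- (r / 2) * (cosh (2 * u) * cos al))
    * cos (r / 2 * (sinh (2 * u) * sin al) + d) * cos (x * cosh u).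
Proof.
  assert (E0 : - (al / 2) + al / 2 = 0) by ring.
  assert (E1 : - (al / 2) + (al / 2 + PI) = PI) by ring.
  unfold ker_re; rewrite !phase_re_shift by (rewrite ?E0, ?E1; auto using sin_0, sin_PI).
  rewrite !phase_im_shift, E0, E1, cos_0, cos_PI, <- Rmult_plus_distr_l.
  set (q := r / 2 * (sinh (2 * u) * sin al)).
  replace (q + x * (cosh u * 1) + d) with ((q + d) + x * cosh u) by ring.
  replace (q + x * (cosh u * -1) + d) with ((q + d) - x * cosh u) by ring.
  rewrite cos_sum_product; field.
Qed.

Lemma is_RInt_gen_ker_shift (r x al d : R) :
  0 < r -> 0 <= x -> 0 < al <= PI / 2 ->
  is_RInt_gen (fun u => exp (- (r / 2) * (cosh (2 * u) * cos al))
      * cos (r / 2 * (sinh (2 * u) * sin al) + d) * cos (x * cosh u))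
    (Rbar_locally m_infty) (Rbar_locally p_infty)
    (/ 2 * (pot_lim r x (al / 2) d + pot_lim r x (al / 2 + PI) d)
     - / 2 * (- pot_lim r x (- (al / 2)) d - pot_lim r x (- (al / 2 + PI)) d)).
Proof.
  intros Hr Hx Hal.
  assert (Hg : forall b, Rabs (sin (b + (al / 2 + PI))) = Rabs (sin (b + al / 2))).
  { intros b; rewrite <- Rplus_assoc, neg_sin, Rabs_Ropp; auto. }
  apply (is_RInt_gen_primitive _ _ _ (fun u =>
    / 2 * (pot r x (al / 2) d u (- (al / 2))
           + pot r x (al / 2 + PI) d u (- (al / 2))))).
  - apply filter_forall; intros ab u _; split.
    + rewrite <- ker_re_shift_sum.
      apply (is_derive_scal (fun u => pot r x (al / 2) d u (- (al / 2))
               + pot r x (al / 2 + PI) d u (- (al / 2)))).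
      apply (is_derive_plus (fun u => pot r x (al / 2) d u (- (al / 2)))
               (fun u => pot r x (al / 2 + PI) d u (- (al / 2))));
        apply is_derive_pot_a.
    + match goal with |- continuous ?f _ => apply (ex_derive_continuous f) end.
      unfold cosh, sinh; auto_derive; auto.
  - apply (is_lim_scal_l (fun u => pot r x (al / 2) d u (- (al / 2))
               + pot r x (al / 2 + PI) d u (- (al / 2))) (/ 2) m_infty
             (- pot_lim r x (- (al / 2)) d - pot_lim r x (- (al / 2 + PI)) d)).
    apply (is_lim_plus _ _ m_infty (- pot_lim r x (- (al / 2)) d)
             (- pot_lim r x (- (al / 2 + PI)) d)); [| |reflexivity];
      apply is_lim_pot_shift_m; auto.
  - apply (is_lim_scal_l (fun u => pot r x (al / 2) d u (- (al / 2))
               + pot r x (al / 2 + PI) d u (- (al / 2))) (/ 2) p_infty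
             (pot_lim r x (al / 2) d + pot_lim r x (al / 2 + PI) d)).
    apply (is_lim_plus _ _ p_infty (pot_lim r x (al / 2) d)
             (pot_lim r x (al / 2 + PI) d)); [| |reflexivity];
      apply is_lim_pot_shift_p; auto.
Qed.

Lemma pot_lim_conj (r x g h d : R) : sin h = sin g -> cos h = - cos g ->
  pot_lim r x h d = pot_lim r x g (- d).
Proof.
  intros Hs Hc; unfold pot_lim; apply (f_equal real).
  symmetry; apply (Lim_ext (fun t => pot r x h d t 0) (fun t => pot r x g (- d) t 0)).
  intros t; exact (pot_axis_conj r x g h d t Hs Hc).
Qed.

Lemma pot_lim_PI (r x g d : R) : pot_lim r x (g + PI) d = pot_lim r x (- g) (- d).
Proof.
  apply pot_lim_conj; [rewrite neg_sin, sin_neg | rewrite neg_cos, cos_neg]; ring.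
Qed.

Lemma pot_lim_PI_opp (r x g d : R) : pot_lim r x (- (g + PI)) d = pot_lim r x g (- d).
Proof.
  apply pot_lim_conj; rewrite ?sin_neg, ?cos_neg, ?neg_sin, ?neg_cos; ring.
Qed.

Lemma pot_lim_d_opp (r x g : R) :
  pot_lim r x g (PI / 2) = - pot_lim r x g (- (PI / 2)).
Proof.
  unfold pot_lim; rewrite <- Rbar_opp_real, <- Lim_opp; apply (f_equal real).
  symmetry; apply (Lim_ext (fun t => pot r x g (PI / 2) t 0)
           (fun t => - pot r x g (- (PI / 2)) t 0)).
  intros t; apply pot_axis_d_opp.
Qed.

Lemma is_RInt_gen_F (x rho alpha : R) :
  0 < rho -> 0 <= x -> 0 < alpha <= PI / 2 ->
  is_RInt_gen (V := C_R_NormedModule) (F_integrand x rho alpha)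
    (Rbar_locally m_infty) (Rbar_locally p_infty)
    (RtoC (pot_lim rho x (alpha / 2) 0 + pot_lim rho x (- (alpha / 2)) 0)).
Proof.
  intros Hr Hx Hal.
  assert (H0 := is_RInt_gen_ker_shift rho x alpha 0 Hr Hx Hal).
  assert (H1 := is_RInt_gen_ker_shift rho x alpha (- (PI / 2)) Hr Hx Hal).
  (* Conjugation reduces the four half lines to the two values [g = alpha / 2] and
     [g = - alpha / 2]. *)
  rewrite pot_lim_PI, pot_lim_PI_opp in H0, H1.
  rewrite Ropp_involutive, !pot_lim_d_opp in H1; rewrite Ropp_0 in H0.
  apply (is_RInt_gen_C _ _).
  - replace (pot_lim rho x (alpha / 2) 0 + pot_lim rho x (- (alpha / 2)) 0) with
      (/ 2 * (pot_lim rho x (alpha / 2) 0 + pot_lim rho x (- (alpha / 2)) 0) -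
       / 2 * (- pot_lim rho x (- (alpha / 2)) 0 - pot_lim rho x (alpha / 2) 0)) by field.
    apply (fun E => is_RInt_gen_ext _ _ _ E H0).
    apply filter_forall; intros ab u _; rewrite F_integrand_eq, Rplus_0_r; reflexivity.
  (* In the imaginary part conjugation costs a sign, and the four contributions cancel in pairs. *)
  - match type of H1 with is_RInt_gen _ _ _ ?l => replace 0 with l by ring end.
    apply (fun E => is_RInt_gen_ext _ _ _ E H1).
    apply filter_forall; intros ab u _; rewrite F_integrand_eq; simpl.
    replace (rho / 2 * (sinh (2 * u) * sin alpha) + - (PI / 2)) with
      (- (PI / 2 - rho / 2 * (sinh (2 * u) * sin alpha))) by ring.
    rewrite cos_neg, cos_shift; reflexivity.
Qed.

Lemma F_eq (x rho alpha : R) :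
  0 < rho -> 0 <= x -> 0 < alpha <= PI / 2 ->
  F x rho alpha =
    RtoC (pot_lim rho x (alpha / 2) 0 + pot_lim rho x (- (alpha / 2)) 0).
Proof.
  intros Hr Hx Hal; unfold F.
  apply (is_RInt_gen_unique (V := C_R_CompleteNormedModule)), is_RInt_gen_F; auto.
Qed.

(** * The path through the saddle point *)

(* The curve [z(v) = curve_a Y v + i v] is the preimage of the horizontal line
   [Im w = Y] under [w = cosh z]; [curve_w Y v] is [Re w]. *)
Definition curve_a (Y v : R) : R := arcsinh (Y / sin v).

Definition curve_w (Y v : R) : R := cosh (curve_a Y v) * cos v.

Lemma sinh_curve_a (Y v : R) : sinh (curve_a Y v) = Y / sin v.
Proof. apply sinh_arcsinh. Qed.

Lemma is_derive_curve_a (Y v : R) : 0 < sin v ->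
  is_derive (curve_a Y) v
    (- (sinh (curve_a Y v) * cos v / (cosh (curve_a Y v) * sin v))).
Proof.
  intros Hs.
  assert (Hc := cosh_ge_1 (curve_a Y v)).
  assert (Hd : is_derive (fun v => Y / sin v) v (- (Y * cos v / sin v ^ 2))).
  { auto_derive; [lra | field; lra]. }
  assert (Ha : is_derive arcsinh (Y / sin v) (/ cosh (curve_a Y v))).
  { apply is_derive_Reals.
    replace (cosh (curve_a Y v)) with (sqrt ((Y / sin v) ^ 2 + 1)).
    - apply derivable_pt_lim_arcsinh.
    - apply sqrt_lem_1; [generalize (pow2_ge_0 (Y / sin v)); lra | lra |].
      generalize (cosh2_sinh2 (curve_a Y v)); rewrite sinh_curve_a; lra. }
  apply (is_derive_eq _ _ _ _ (is_derive_comp arcsinh (fun v => Y / sin v) v _ _ Ha Hd)).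
  rewrite sinh_curve_a; unfold scal; simpl; unfold mult; simpl; field; lra.
Qed.

(** Since dw/dz = sinh z and |sinh z|^2 = sinh(a)^2 + sin(v)^2, Re w strictly decreases along the
    curve and can serve as its parameter. *)
Lemma is_derive_curve_w (Y v : R) : 0 < sin v ->
  is_derive (curve_w Y) v
    (- ((sinh (curve_a Y v) ^ 2 + sin v ^ 2) / (cosh (curve_a Y v) * sin v))).
Proof.
  intros Hs.
  assert (Hc := cosh_ge_1 (curve_a Y v)).
  assert (H1 := is_derive_comp cosh (curve_a Y) v _ _
                  (is_derive_cosh _) (is_derive_curve_a Y v Hs)).
  assert (H2 : is_derive cos v (- sin v)) by (auto_derive; auto; ring).
  apply (is_derive_eq _ _ _ _
    (is_derive_mult (fun v => cosh (curve_a Y v)) cos v _ _ H1 H2 Rmult_comm)).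
  unfold scal, plus, mult; simpl; unfold mult; simpl.
  generalize (cosh2_sinh2 (curve_a Y v)) (sin2_cos2 v); unfold Rsqr.
  set (S := sinh _); set (C := cosh _) in *; intros E1 E2.
  apply Rmult_eq_reg_r with (C * sin v); [|nra].
  field_simplify; [|nra|nra].
  replace (C ^ 2) with (1 + S ^ 2) by lra.
  replace (cos v ^ 2) with (1 - sin v ^ 2) by lra; ring.
Qed.

(** This bounds |sinh z| below by [Y], hence |dz| above by |dw|/Y. *)
Lemma sinh_curve_a_ge (Y v : R) : 0 < Y -> 0 < sin v -> Y <= sinh (curve_a Y v).
Proof.
  intros HY Hs; rewrite sinh_curve_a.
  apply Rmult_le_reg_r with (sin v); auto.
  unfold Rdiv; rewrite Rmult_assoc, Rinv_l by lra.
  generalize (SIN_bound v); nra.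
Qed.

Lemma is_derive_pot_curve (r x g d Y v : R) : 0 < sin v ->
  is_derive (fun v => pot r x g d (curve_a Y v) v) v
    (ker_re r x g d (curve_a Y v) v
       * (- (sinh (curve_a Y v) * cos v / (cosh (curve_a Y v) * sin v)))
     - ker_im r x g d (curve_a Y v) v).
Proof.
  intros Hs; apply is_derive_Reals.
  replace (_ - _) with
    (ker_re r x g d (curve_a Y v) v
       * (- (sinh (curve_a Y v) * cos v / (cosh (curve_a Y v) * sin v)))
     + - ker_im r x g d (curve_a Y v) v * 1) by ring.
  apply (derivable_pt_lim_comp_2d (pot r x g d) (curve_a Y) (fun v => v)).
  - apply differentiable_pot.
  - apply is_derive_Reals, is_derive_curve_a; auto.
  - apply derivable_pt_lim_id.
Qed.

(** Cauchy-Schwarz: the real part of a rotated tangent vector (t, 1) is at most its length. *)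
Lemma Rabs_rotate_le (p t w : R) : 0 <= w -> 1 + t ^ 2 <= w ^ 2 ->
  Rabs (cos p * t - sin p) <= w.
Proof.
  intros Hw H; rewrite <- (Rabs_pos_eq w Hw); apply Rsqr_le_abs_0.
  generalize (sin2_cos2 p) (pow2_ge_0 (sin p * t + cos p)); unfold Rsqr.
  intros E1 E2; nra.
Qed.

(** The left side is the real part of exp(i d) e_g(z) dz/dv, of modulus at most exp(phase_re)
    |dz/dv|; then |dz| = |dw|/|sinh z| <= |dw|/Y, and the last factor on the right is |dw/dv|/Y. *)
Lemma pot_curve_derive_le (r x g d Y v : R) : 0 < Y -> 0 < sin v ->
  Rabs (ker_re r x g d (curve_a Y v) v
       * (- (sinh (curve_a Y v) * cos v / (cosh (curve_a Y v) * sin v)))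
     - ker_im r x g d (curve_a Y v) v)
  <= exp (phase_re r x g (curve_a Y v) v)
     * (((sinh (curve_a Y v) ^ 2 + sin v ^ 2) / (cosh (curve_a Y v) * sin v)) / Y).
Proof.
  intros HY Hs.
  assert (HS := sinh_curve_a_ge Y v HY Hs).
  assert (HC := cosh_ge_1 (curve_a Y v)).
  assert (E1 := cosh2_sinh2 (curve_a Y v)).
  assert (E2 := sin2_cos2 v); unfold Rsqr in E2.
  unfold ker_re, ker_im.
  set (S := sinh _) in *; set (C := cosh _) in *; set (p := _ + d).
  set (t := - (S * cos v / (C * sin v))).
  replace (exp (phase_re r x g (curve_a Y v) v) * cos p * t - exp (phase_re r x g (curve_a Y v) v) * sin p)
    with (exp (phase_re r x g (curve_a Y v) v) * (cos p * t - sin p)) by ring.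
  rewrite Rabs_mult, (Rabs_pos_eq (exp _)); [|left; apply exp_pos].
  apply Rmult_le_compat_l; [left; apply exp_pos|].
  assert (HCs : 0 < C * sin v) by (apply Rmult_lt_0_compat; lra).
  assert (H2 : 0 < S ^ 2 + sin v ^ 2) by nra.
  assert (E3 : 1 + t ^ 2 = (S ^ 2 + sin v ^ 2) / (C * sin v) ^ 2).
  { unfold t; apply Rmult_eq_reg_r with ((C * sin v) ^ 2); [|nra].
    field_simplify; [|lra|lra].
    replace (C ^ 2) with (1 + S ^ 2) by lra.
    replace (cos v ^ 2) with (1 - sin v ^ 2) by lra; ring. }
  apply Rabs_rotate_le.
  - left; repeat apply Rdiv_lt_0_compat; auto.
  - rewrite E3.
    replace (((S ^ 2 + sin v ^ 2) / (C * sin v) / Y) ^ 2) with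
      ((S ^ 2 + sin v ^ 2) / (C * sin v) ^ 2 * ((S ^ 2 + sin v ^ 2) / Y ^ 2))
      by (field; lra).
    rewrite <- (Rmult_1_r (_ / _)) at 1.
    apply Rmult_le_compat_l.
    + left; apply Rdiv_lt_0_compat; auto; nra.
    + apply Rmult_le_reg_r with (Y ^ 2); [nra|].
      unfold Rdiv; rewrite Rmult_assoc, Rinv_l by nra; nra.
Qed.

(** With w = cosh z one has cosh 2z = 2 w^2 - 1, so the first term is quadratic in Re w. The choice
    of [Y] makes r Y^2 - x Y cos g equal to -M cos(g)^2. What remains is at most x |sin g| Re w,
    because sinh a <= cosh a, and completing the square in Re w produces M sin(g)^2. *)
Lemma phase_re_curve (r x g Y v : R) :
  0 < r -> 0 <= x -> 0 < Y -> Y = x * cos g / (2 * r) -> 0 < sin v -> 0 <= cos v ->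
  phase_re r x g (curve_a Y v) v <=
    r / 2 - x ^ 2 / (4 * r) * (cos g ^ 2 - sin g ^ 2)
    - r * (curve_w Y v - x * Rabs (sin g) / (2 * r)) ^ 2.
Proof.
  intros Hr Hx HY EY Hs Hc.
  assert (HC := cosh_ge_1 (curve_a Y v)).
  assert (HS := sinh_curve_a_ge Y v HY Hs).
  assert (E0 : sinh (curve_a Y v) * sin v = Y)
    by (rewrite sinh_curve_a; field; lra).
  assert (E1 := cosh2_sinh2 (curve_a Y v)).
  assert (E2 := sin2_cos2 v); unfold Rsqr in E2.
  unfold phase_re, curve_w; rewrite cosh_double, cos_2a_cos, sin_plus.
  set (S := sinh _) in *; set (C := cosh _) in *.
  assert (HSC : S * cos v <= C * cos v) by (apply Rmult_le_compat_r; nra).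
  assert (H1 : - (S * (cos v * sin g)) <= C * cos v * Rabs (sin g)).
  { apply Rle_trans with (S * cos v * Rabs (sin g)).
    - generalize (Rle_abs (- sin g)); rewrite Rabs_Ropp; intros H.
      apply (Rmult_le_compat_l (S * cos v)) in H; [lra|].
      apply Rmult_le_pos; lra.
    - apply Rmult_le_compat_r; auto; apply Rabs_pos. }
  apply (Rmult_le_compat_l x) in H1; auto.
  assert (E3 : (1 + 2 * S ^ 2) * (2 * cos v * cos v - 1) =
               2 * ((C * cos v) ^ 2 - Y ^ 2) - 1).
  { rewrite <- E0, !Rpow_mult_distr.
    replace (C ^ 2) with (1 + S ^ 2) by lra.
    replace (sin v ^ 2) with (1 - cos v * cos v) by lra; ring. }
  rewrite E3.
  assert (E4 : r * (C * cos v - x * Rabs (sin g) / (2 * r)) ^ 2 =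
    r * (C * cos v) ^ 2 - x * (C * cos v * Rabs (sin g))
      + x ^ 2 / (4 * r) * sin g ^ 2).
  { rewrite <- (pow2_abs (sin g)); field; lra. }
  rewrite E4.
  assert (E5 : r * Y ^ 2 - x * (Y * cos g) = - (x ^ 2 / (4 * r) * cos g ^ 2)).
  { rewrite EY; field; lra. }
  replace (x * (S * (sin v * cos g + cos v * sin g))) with
    (x * (Y * cos g) - x * - (S * (cos v * sin g))) by (rewrite <- E0; ring).
  lra.
Qed.

(** Trades the Gaussian in Re w for 1/(1 + y), whose primitive is an arctangent; the total mass
    changes only by a constant factor. *)
Lemma exp_opp_le_inv (y : R) : 0 <= y -> exp (- y) <= / (1 + y).
Proof.
  intros H; rewrite exp_Ropp; apply Rinv_le_contravar; [lra|].
  apply exp_ineq1_le.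
Qed.

(** The bound does not involve [v0], so it covers the whole infinite curve as [v0] tends to 0. The
    factor [PI] is the total variation of the arctangent. *)
Lemma pot_curve_increment (r x g d Y v0 : R) :
  0 < r -> 0 <= x -> 0 < Y -> Y = x * cos g / (2 * r) -> 0 < v0 <= PI / 2 ->
  Rabs (pot r x g d (curve_a Y (PI / 2)) (PI / 2) - pot r x g d (curve_a Y v0) v0)
  <= exp (r / 2 - x ^ 2 / (4 * r) * (cos g ^ 2 - sin g ^ 2)) * PI / (Y * sqrt r).
Proof.
  intros Hr Hx HY EY Hv0.
  assert (Hsr := sqrt_lt_R0 r Hr).
  set (K := exp (r / 2 - x ^ 2 / (4 * r) * (cos g ^ 2 - sin g ^ 2))).
  assert (HK : 0 < K) by apply exp_pos.
  set (w0 := x * Rabs (sin g) / (2 * r)).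
  (* A primitive of the Lorentzian majorant in the variable Re w; the minus sign is there because Re
     w decreases as [v] grows. *)
  set (Phi := fun v => - (K / (Y * sqrt r)) * atan (sqrt r * (curve_w Y v - w0))).
  assert (Hsin : forall v, v0 <= v <= PI / 2 -> 0 < sin v /\ 0 <= cos v).
  { intros v Hv; split; [apply sin_gt_0; lra | apply cos_ge_0; lra]. }
  apply Rle_trans with (Phi (PI / 2) - Phi v0).
  - apply (increment_dominated (fun v => pot r x g d (curve_a Y v) v) Phi
      (fun v => ker_re r x g d (curve_a Y v) v
       * (- (sinh (curve_a Y v) * cos v / (cosh (curve_a Y v) * sin v)))
       - ker_im r x g d (curve_a Y v) v)
      (fun v => K / (1 + r * (curve_w Y v - w0) ^ 2)
        * (((sinh (curve_a Y v) ^ 2 + sin v ^ 2) / (cosh (curve_a Y v) * sin v)) / Y)));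
      [lra| | |].
    + intros v Hv; apply is_derive_pot_curve, Hsin; auto.
    + intros v Hv; destruct (Hsin v Hv) as [Hs _].
      assert (HC := cosh_ge_1 (curve_a Y v)).
      assert (H1 := is_derive_curve_w Y v Hs).
      assert (H2 : is_derive (fun w => - (K / (Y * sqrt r)) * atan (sqrt r * (w - w0)))
                (curve_w Y v) (- (K / Y / (1 + r * (curve_w Y v - w0) ^ 2)))).
      { assert (0 <= r * (curve_w Y v - w0) ^ 2)
          by (apply Rmult_le_pos; [lra | apply pow2_ge_0]).
        auto_derive; auto.
        replace (sqrt r * (curve_w Y v + - w0) * (sqrt r * (curve_w Y v + - w0) * 1))
          with (sqrt r * sqrt r * (curve_w Y v - w0) ^ 2) by ring.
        rewrite sqrt_sqrt by lra; field; repeat split; try lra. }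
      apply (is_derive_eq _ _ _ _ (is_derive_comp _ (curve_w Y) v _ _ H2 H1)).
      assert (0 <= r * (curve_w Y v - w0) ^ 2)
        by (apply Rmult_le_pos; [lra | apply pow2_ge_0]).
      unfold scal; simpl; unfold mult; simpl; field.
      repeat split; lra.
    + intros v Hv; destruct (Hsin v Hv) as [Hs Hc].
      apply Rle_trans with (1 := pot_curve_derive_le r x g d Y v HY Hs).
      apply Rmult_le_compat_r.
      { assert (HC := cosh_ge_1 (curve_a Y v)).
        left; repeat apply Rdiv_lt_0_compat; auto; [|nra].
        generalize (pow2_ge_0 (sinh (curve_a Y v))); nra. }
      assert (H0 : 0 <= r * (curve_w Y v - w0) ^ 2)
        by (apply Rmult_le_pos; [lra | apply pow2_ge_0]).
      apply Rle_trans with (K * exp (- (r * (curve_w Y v - w0) ^ 2))).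
      * unfold K; rewrite <- exp_plus; apply exp_le_compat.
        apply Rle_trans with (1 := phase_re_curve r x g Y v Hr Hx HY EY Hs Hc).
        fold w0; lra.
      * apply Rmult_le_compat_l; [lra|].
        apply exp_opp_le_inv; auto.
  - unfold Phi.
    assert (H1 := atan_bound (sqrt r * (curve_w Y (PI / 2) - w0))).
    assert (H2 := atan_bound (sqrt r * (curve_w Y v0 - w0))).
    assert (H3 : 0 < K / (Y * sqrt r))
      by (apply Rdiv_lt_0_compat; auto; apply Rmult_lt_0_compat; auto).
    replace (K * PI / (Y * sqrt r)) with (K / (Y * sqrt r) * PI)
      by (field; lra).
    apply Rle_trans with (K / (Y * sqrt r) *
      (atan (sqrt r * (curve_w Y v0 - w0)) - atan (sqrt r * (curve_w Y (PI / 2) - w0))));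
      [right; ring|].
    apply Rmult_le_compat_l; lra.
Qed.

(** Closes the gap between the curve and the axis far to the right. The segment is shorter than 1,
    since [PI / 6 < 1], and up to that height cos 2b is at least 1/2. *)
Lemma pot_near_axis (r x g d t v : R) :
  0 < r -> 0 <= x -> 0 <= t -> 0 <= v <= PI / 6 ->
  Rabs (pot r x g d t v - pot r x g d t 0)
    <= exp ((x + 1) ^ 2 / (4 * (r / 2))) * exp (- (1 * t)).
Proof.
  intros Hr Hx Ht Hv.
  assert (HPI := PI_RGT_0); assert (HPI4 := PI_4).
  set (K := exp ((x + 1) ^ 2 / (4 * (r / 2))) * exp (- (1 * t))).
  assert (HK : 0 < K) by (apply Rmult_lt_0_compat; apply exp_pos).
  apply Rle_trans with (K * v - K * 0); [|nra].
  apply (increment_dominated (pot r x g d t) (fun b => K * b)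
           (fun b => - ker_im r x g d t b) (fun _ => K)); [lra| | |].
  - intros b _; apply is_derive_pot_b.
  - intros b _; auto_derive; auto; ring.
  - intros b Hb; rewrite Rabs_Ropp.
    apply Rle_trans with (1 := Rabs_ker_im_le _ _ _ _ _ _).
    unfold K; rewrite <- exp_plus; apply exp_le_compat.
    assert (Hk : 1 / 2 <= cos (2 * b))
      by (rewrite <- cos_PI3; apply cos_decr_1; lra).
    apply Rle_trans with (1 := phase_re_le r x g t b (1 / 2) ltac:(lra) Hx Hk).
    generalize (phase_decay (r / 2) x t ltac:(lra)); rewrite (Rabs_pos_eq t Ht); lra.
Qed.

Lemma pot_lim_corner (r x g d Y : R) :
  0 < r -> 0 <= x -> 0 < Y -> Y = x * cos g / (2 * r) ->
  Rabs (pot_lim r x g d - pot r x g d (arcsinh Y) (PI / 2))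
  <= exp (r / 2 - x ^ 2 / (4 * r) * (cos g ^ 2 - sin g ^ 2)) * PI / (Y * sqrt r).
Proof.
  intros Hr Hx HY EY.
  assert (HPI := PI_RGT_0).
  set (b := exp _ * PI / _).
  set (K := exp ((x + 1) ^ 2 / (4 * (r / 2)))).
  assert (Hlim : is_lim (fun t => Rabs (pot r x g d t 0 - pot r x g d (arcsinh Y) (PI / 2)))
            p_infty (Rabs (pot_lim r x g d - pot r x g d (arcsinh Y) (PI / 2)))).
  { apply (is_lim_Rabs _ p_infty (pot_lim r x g d - pot r x g d (arcsinh Y) (PI / 2))).
    apply (is_lim_minus (fun t => pot r x g d t 0) (fun _ => pot r x g d (arcsinh Y) (PI / 2))
             p_infty (pot_lim r x g d) (pot r x g d (arcsinh Y) (PI / 2)));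
      [apply is_lim_pot; auto | apply is_lim_const | reflexivity]. }
  assert (Hlim' : is_lim (fun t => b + K * exp (- (1 * t))) p_infty (b + 0)).
  { apply (is_lim_plus (fun _ => b) (fun t => K * exp (- (1 * t))) p_infty b 0);
      [apply is_lim_const | apply is_lim_exp_opp; lra | reflexivity]. }
  enough (H : Rbar_le (Rabs (pot_lim r x g d - pot r x g d (arcsinh Y) (PI / 2))) (b + 0))
    by (simpl in H; lra).
  apply (is_lim_le_loc _ _ p_infty) with (2 := Hlim) (3 := Hlim').
  (* As sinh t >= t > 2 Y, the point of the curve with abscissa [t] has height asin(Y / sinh t) at
     most [PI / 6], as [pot_near_axis] demands. *)
  exists (2 * Y); intros t Ht.
  assert (Hst := sinh_ge t ltac:(lra)).
  set (v := asin (Y / sinh t)).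
  assert (Hq : 0 < Y / sinh t <= 1 / 2).
  { split; [apply Rdiv_lt_0_compat; lra|].
    apply Rmult_le_reg_r with (sinh t); [lra|].
    unfold Rdiv; rewrite Rmult_assoc, Rinv_l by lra; lra. }
  assert (Hv : sin v = Y / sinh t) by (apply sin_asin; lra).
  assert (Hvb := asin_bound (Y / sinh t)); fold v in Hvb.
  assert (Hv0 : 0 < v).
  { apply sin_increasing_0; try lra; rewrite sin_0, Hv; lra. }
  assert (Hv6 : v <= PI / 6).
  { apply sin_incr_0; try lra; rewrite sin_PI6, Hv; lra. }
  assert (Hcurve : curve_a Y v = t).
  { unfold curve_a; rewrite Hv.
    replace (Y / (Y / sinh t)) with (sinh t) by (field; lra); apply arcsinh_sinh. }
  assert (H1 := pot_near_axis r x g d t v Hr Hx ltac:(lra) ltac:(lra)); fold K in H1.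
  assert (H2 := pot_curve_increment r x g d Y v Hr Hx HY EY ltac:(lra)); fold b in H2.
  rewrite Hcurve in H2; unfold curve_a in H2; rewrite sin_PI2, Rdiv_1_r in H2.
  replace (pot r x g d t 0 - pot r x g d (arcsinh Y) (PI / 2)) with
    (- (pot r x g d t v - pot r x g d t 0)
     + - (pot r x g d (arcsinh Y) (PI / 2) - pot r x g d t v)) by ring.
  apply Rle_trans with (1 := Rabs_triang _ _); rewrite !Rabs_Ropp; lra.
Qed.

(** Path independence: the value at the corner is recomputed along the imaginary axis and then along
    the line of height [PI / 2], where cos 2b = -1 reverses the sign of the cosh term. *)
Lemma pot_corner (r x g a : R) :
  pot r x g 0 a (PI / 2) =
    - RInt (fun v => exp (- (r / 2) * cos (2 * v)) * sin (x * cos (v + g))) 0 (PI / 2)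
    + RInt (fun u => exp (r / 2 * cosh (2 * u) - x * cos g * sinh u)
                     * cos (x * sin g * cosh u)) 0 a.
Proof.
  assert (H : is_RInt (fun u => ker_re r x g 0 u (PI / 2)) 0 a
                (pot r x g 0 a (PI / 2) - pot r x g 0 0 (PI / 2))).
  { apply (is_RInt_derive (fun u => pot r x g 0 u (PI / 2))).
    - intros u _; apply is_derive_pot_a.
    - intros u _; apply (continuity_2d_continuous_1 (ker_re r x g 0)).
      apply continuity_2d_ker_re. }
  apply (is_RInt_unique (V := R_CompleteNormedModule)) in H.
  replace (pot r x g 0 a (PI / 2)) with
    (pot r x g 0 0 (PI / 2) + RInt (fun u => ker_re r x g 0 u (PI / 2)) 0 a)
    by (rewrite H; ring).
  f_equal.
  - unfold pot; rewrite RInt_point; unfold zero; simpl.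
    rewrite Rminus_0_l; f_equal; apply RInt_ext; intros v _.
    unfold ker_im, phase_re, phase_im.
    rewrite !Rmult_0_r, sinh_0, cosh_0.
    f_equal; f_equal; ring.
  - apply RInt_ext; intros u _; unfold ker_re, phase_re, phase_im.
    replace (2 * (PI / 2)) with PI by field; rewrite cos_PI, sin_PI.
    replace (PI / 2 + g) with (g + PI / 2) by ring.
    rewrite <- (Rplus_comm (PI / 2)), <- cos_sin.
    rewrite (cos_plus (PI / 2)), cos_PI2, sin_PI2.
    rewrite <- (cos_neg (x * sin g * cosh u)).
    f_equal; f_equal; ring.
Qed.

Lemma ex_RInt_derivable (f : R -> R) (a b : R) :
  (forall t, ex_derive f t) -> ex_RInt f a b.
Proof.
  intros H; apply (ex_RInt_continuous f); intros t _.
  apply (ex_derive_continuous f), H.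
Qed.

Lemma pot_lim_sum (r x al : R) :
  0 < r -> 0 < x -> 0 < al <= PI / 2 ->
  let s := sin (al / 2) in
  let c := cos (al / 2) in
  let M := x ^ 2 / (4 * r) in
  Rabs (pot_lim r x (al / 2) 0 + pot_lim r x (- (al / 2)) 0
        - (- (2 * RInt (fun v => exp (- (r / 2) * cos (2 * v))
                 * (sin (x * c * cos v) * cos (x * s * sin v))) 0 (PI / 2))
           + 2 * RInt (fun u => exp (r / 2 * cosh (2 * u) - x * c * sinh u)
                     * cos (x * s * cosh u)) 0 (arcsinh (x * c / (2 * r)))))
  <= 2 * (exp (r / 2) * PI / c) * (/ sqrt M * exp (- (M * cos al))).
Proof.
  intros Hr Hx Hal s c M.
  assert (HPI := PI_RGT_0).
  assert (Hc : 0 < c) by (apply cos_gt_0; lra).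
  set (Y := x * c / (2 * r)).
  assert (HY : 0 < Y) by (apply Rdiv_lt_0_compat; nra).
  assert (Hsr := sqrt_lt_R0 r Hr).
  assert (HM : 0 < M) by (apply Rdiv_lt_0_compat; nra).
  assert (HsM : sqrt M = x / (2 * sqrt r)).
  { apply sqrt_lem_1; [lra | left; apply Rdiv_lt_0_compat; lra |].
    unfold M; replace (4 * r) with (4 * (sqrt r * sqrt r)) by (rewrite sqrt_sqrt; lra).
    field; lra. }
  assert (Hcos : cos al = c ^ 2 - s ^ 2).
  { replace al with (2 * (al / 2)) by field; rewrite cos_2a; unfold c, s; ring. }
  (* Here [Y * sqrt r = c * sqrt M], and cos(al) = c^2 - s^2 is the saddle exponent. *)
  assert (Hb : exp (r / 2 - M * (c ^ 2 - s ^ 2)) * PI / (Y * sqrt r)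
            = (exp (r / 2) * PI / c) * (/ sqrt M * exp (- (M * cos al)))).
  { rewrite Hcos, HsM; unfold Rminus at 1; rewrite exp_plus; unfold Y.
    replace (2 * r) with (2 * (sqrt r * sqrt r)) by (rewrite sqrt_sqrt; lra).
    field; lra. }
  assert (H1 := pot_lim_corner r x (al / 2) 0 Y Hr ltac:(lra) HY eq_refl).
  assert (H2 := pot_lim_corner r x (- (al / 2)) 0 Y Hr ltac:(lra) HY
                  ltac:(unfold Y, c; rewrite cos_neg; reflexivity)).
  rewrite pot_corner in H1, H2; rewrite cos_neg, sin_neg in H2.
  fold s c M in H1, H2.
  replace ((- s) ^ 2) with (s ^ 2) in H2 by ring.
  rewrite Hb in H1, H2.
  rewrite (RInt_ext (fun u => exp (r / 2 * cosh (2 * u) - x * c * sinh u)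
             * cos (x * - s * cosh u)) (fun u => exp (r / 2 * cosh (2 * u) - x * c * sinh u)
             * cos (x * s * cosh u))) in H2.
  2:{ intros u _; rewrite <- (cos_neg (x * s * cosh u)); do 2 f_equal; ring. }
  assert (E : 2 * RInt (fun v => exp (- (r / 2) * cos (2 * v))
                 * (sin (x * c * cos v) * cos (x * s * sin v))) 0 (PI / 2)
      = RInt (fun v => exp (- (r / 2) * cos (2 * v)) * sin (x * cos (v + al / 2))) 0 (PI / 2)
        + RInt (fun v => exp (- (r / 2) * cos (2 * v)) * sin (x * cos (v + - (al / 2)))) 0 (PI / 2)).
  { eapply eq_trans; [symmetry; apply (RInt_scal (V := R_CompleteNormedModule)
                 (fun v => exp (- (r / 2) * cos (2 * v))
                 * (sin (x * c * cos v) * cos (x * s * sin v))) 0 (PI / 2) 2)|].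
    { apply ex_RInt_derivable; intros t; auto_derive; auto. }
    eapply eq_trans; [|apply (RInt_plus (V := R_CompleteNormedModule)
       (fun v => exp (- (r / 2) * cos (2 * v)) * sin (x * cos (v + al / 2)))
       (fun v => exp (- (r / 2) * cos (2 * v)) * sin (x * cos (v + - (al / 2)))))].
    2,3: apply ex_RInt_derivable; intros t; auto_derive; auto.
    apply RInt_ext; intros v _; unfold scal, plus; simpl; unfold mult; simpl.
    rewrite !cos_plus, cos_neg, sin_neg; fold s c.
    replace (x * (cos v * c - sin v * s)) with (x * c * cos v - x * s * sin v) by ring.
    replace (x * (cos v * c - sin v * - s)) with (x * c * cos v + x * s * sin v) by ring.
    rewrite <- Rmult_plus_distr_l, (Rplus_comm (sin _)), sin_sum_product; ring. }
  rewrite E.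
  set (L1 := pot_lim _ _ (al / 2) 0) in *; set (L2 := pot_lim _ _ (- (al / 2)) 0) in *.
  match goal with |- Rabs ?p <= _ =>
    match type of H1 with Rabs ?q1 <= _ =>
      match type of H2 with Rabs ?q2 <= _ =>
        replace p with (q1 + q2) by ring end end end.
  apply Rle_trans with (1 := Rabs_triang _ _); lra.
Qed.

(** * Gamma at half integers *)

(** Induction through derivatives: differentiating j! exp t - t^j gives j times the same difference
    for j - 1. *)
Lemma pow_div_fact_le_exp (j : nat) (t : R) : 0 <= t -> t ^ j <= INR (fact j) * exp t.
Proof.
  revert t; induction j as [|j IH]; intros t Ht.
  - simpl; rewrite Rmult_1_l; generalize (exp_ineq1_le t); lra.
  - assert (Ec : INR (fact (S j)) = INR (S j) * INR (fact j))
      by (rewrite fact_simpl, mult_INR; auto).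
    generalize (INR_fact_lt_0 (S j)); set (c := INR (fact (S j))) in *; intros Hc.
    enough (c * exp 0 - 0 ^ S j <= c * exp t - t ^ S j)
      by (rewrite exp_0, pow_i in H by lia; lra).
    apply (derive_nonneg_le (fun t => c * exp t - t ^ S j)
             (fun t => INR (S j) * (INR (fact j) * exp t - t ^ j))); auto.
    + intros u _; apply (is_derive_eq _ _ (c * exp u - INR (S j) * 1 * u ^ pred (S j))).
      * apply (is_derive_minus (fun t => c * exp t) (fun t => t ^ S j)).
        -- auto_derive; auto; ring.
        -- apply (is_derive_pow (fun t => t) (S j) u 1), (is_derive_id (K := R_AbsRing) u).
      * rewrite Ec; simpl pred; ring.
    + intros u Hu; apply Rmult_le_pos; [apply pos_INR|].
      generalize (IH u ltac:(lra)); lra.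
Qed.

Lemma pow_le_exp (j : nat) (b t : R) : 0 < b -> 0 <= t ->
  t ^ j <= (/ b) ^ j * INR (fact j) * exp (b * t).
Proof.
  intros Hb Ht.
  replace (t ^ j) with ((/ b) ^ j * (b * t) ^ j)
    by (rewrite <- Rpow_mult_distr; f_equal; field; lra).
  rewrite Rmult_assoc; apply Rmult_le_compat_l.
  - apply pow_le; left; apply Rinv_0_lt_compat; auto.
  - apply pow_div_fact_le_exp; nra.
Qed.

Definition gauss (t : R) : R := RInt (fun s => exp (- s ^ 2)) 0 t.

Lemma is_derive_gauss (t : R) : is_derive gauss t (exp (- t ^ 2)).
Proof.
  apply (is_derive_RInt_upper (fun s => exp (- s ^ 2)) t); intros u.
  apply (ex_derive_continuous (fun s => exp (- s ^ 2))); auto_derive; auto.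
Qed.

Lemma gauss_0 : gauss 0 = 0.
Proof. unfold gauss; rewrite RInt_point; reflexivity. Qed.

Lemma gauss_pos (t : R) : 0 <= t -> 0 <= gauss t.
Proof.
  intros Ht; rewrite <- gauss_0.
  apply (derive_nonneg_le gauss (fun t => exp (- t ^ 2))); auto.
  - intros; apply is_derive_gauss.
  - intros; left; apply exp_pos.
Qed.

(** The companion in the classical evaluation of the Gaussian integral: [gauss ^ 2 + gauss_aux] has
    zero derivative, equals arctan 1 at 0, and [gauss_aux] vanishes at infinity. *)
Definition gauss_aux (t : R) : R :=
  RInt (fun y => exp (- (t ^ 2 * (1 + y ^ 2))) / (1 + y ^ 2)) 0 1.

Lemma one_plus_sqr_pos (y : R) : 0 < 1 + y ^ 2.
Proof. generalize (pow2_ge_0 y); lra. Qed.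

Lemma is_derive_gauss_aux (t : R) :
  is_derive gauss_aux t (- 2 * exp (- t ^ 2) * gauss t).
Proof.
  set (f := fun t y : R => exp (- (t ^ 2 * (1 + y ^ 2))) / (1 + y ^ 2)).
  assert (Hd : forall t y, is_derive (fun t => f t y) t
                 (- 2 * (t * exp (- (t ^ 2 * (1 + y ^ 2)))))).
  { intros u y; unfold f; assert (H := one_plus_sqr_pos y).
    auto_derive; [simpl in H; lra|].
    simpl; field; simpl in H; lra. }
  assert (H : is_derive gauss_aux t (RInt (fun y => Derive (fun t => f t y) t) 0 1)).
  { apply (is_derive_RInt_param f 0 1 t).
    - apply filter_forall; intros u y _; eexists; apply Hd.
    - intros y _.
      apply continuity_2d_pt_ext with
        (fun u v => - 2 * (u * exp (-1 * (u * (u * (1 + v * v)))))).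
      + intros u v; symmetry; apply is_derive_unique.
        replace (-1 * (u * (u * (1 + v * v)))) with (- (u ^ 2 * (1 + v ^ 2))) by ring.
        apply Hd.
      + cont2d.
    - apply filter_forall; intros u; apply ex_RInt_derivable; intros y.
      unfold f; auto_derive; generalize (one_plus_sqr_pos y); simpl; lra. }
  apply (is_derive_eq _ _ _ _ H).
  (* The substitution s = t y recovers [gauss t]. *)
  assert (Hs : is_RInt (fun y => t * exp (- (t * y) ^ 2)) 0 1
                 (gauss (t * 1) - gauss (t * 0))).
  { apply (is_RInt_derive (fun y => gauss (t * y))).
    - intros y _.
      apply (is_derive_eq _ _ _ _ (is_derive_comp gauss (fun y => t * y) y _ t
               (is_derive_gauss _) ltac:(auto_derive; auto; ring))).
      reflexivity.
    - intros y _.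
      apply (ex_derive_continuous (fun y => t * exp (- (t * y) ^ 2))).
      auto_derive; auto. }
  rewrite Rmult_1_r, Rmult_0_r, gauss_0, Rminus_0_r in Hs.
  rewrite <- (is_RInt_unique (V := R_CompleteNormedModule) _ _ _ _ Hs).
  eapply eq_trans; [|apply (RInt_scal (V := R_CompleteNormedModule)
    (fun y => t * exp (- (t * y) ^ 2)) 0 1)].
  - apply RInt_ext; intros y _.
    eapply eq_trans; [apply is_derive_unique, Hd|].
    unfold scal; simpl; unfold mult; simpl.
    replace (- (t * (t * 1) * (1 + y * (y * 1)))) with
      (- (t * (t * 1)) + - (t * y * (t * y * 1))) by ring.
    rewrite exp_plus; ring.
  - eexists; exact Hs.
Qed.

Lemma gauss_sqr (t : R) : gauss t ^ 2 = PI / 4 - gauss_aux t.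
Proof.
  assert (Hconst : forall a b, a <= b ->
            gauss a ^ 2 + gauss_aux a <= gauss b ^ 2 + gauss_aux b <=
            gauss a ^ 2 + gauss_aux a).
  { intros a b Hab.
    assert (H : Rabs ((gauss b ^ 2 + gauss_aux b) - (gauss a ^ 2 + gauss_aux a)) <= 0 - 0).
    { apply (increment_dominated (fun t => gauss t ^ 2 + gauss_aux t) (fun _ => 0)
               (fun _ => 0) (fun _ => 0)); auto.
      - intros u _.
        apply (is_derive_eq _ _ _ _ (is_derive_plus _ _ _ _ _
          (is_derive_pow gauss 2 u _ (is_derive_gauss u)) (is_derive_gauss_aux u))).
        unfold plus; simpl; ring.
      - intros u _; apply (is_derive_const (V := R_NormedModule)).
      - intros u _; rewrite Rabs_R0; lra. }
    apply Rabs_le_between in H; lra. }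
  assert (H0 : gauss_aux 0 = PI / 4).
  { replace (PI / 4) with (atan 1 - atan 0) by (rewrite atan_1, atan_0; ring).
    apply is_RInt_unique.
    apply (is_RInt_ext (fun y => / (1 + y ^ 2))).
    - intros y _; replace (- (0 ^ 2 * (1 + y ^ 2))) with 0 by ring.
      rewrite exp_0; unfold Rdiv; symmetry; apply Rmult_1_l.
    - apply (is_RInt_derive atan).
      + intros y _; apply is_derive_Reals.
        apply derivable_pt_lim_atan.
      + intros y _; apply (ex_derive_continuous (fun y => / (1 + y ^ 2))).
        auto_derive; generalize (one_plus_sqr_pos y); simpl; lra. }
  assert (E : gauss t ^ 2 + gauss_aux t = gauss 0 ^ 2 + gauss_aux 0).
  { destruct (Rle_dec 0 t) as [Ht|Ht].
    - generalize (Hconst 0 t Ht); lra.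
    - generalize (Hconst t 0 ltac:(lra)); lra. }
  rewrite gauss_0, H0 in E; lra.
Qed.

Lemma gauss_aux_bound (t : R) : 0 <= gauss_aux t <= exp (- t ^ 2).
Proof.
  assert (Hex : ex_RInt (fun y => exp (- (t ^ 2 * (1 + y ^ 2))) / (1 + y ^ 2)) 0 1).
  { apply ex_RInt_derivable; intros y.
    auto_derive; generalize (one_plus_sqr_pos y); simpl; lra. }
  split.
  - apply RInt_ge_0; [lra|auto|]; intros y _.
    left; apply Rdiv_lt_0_compat; [apply exp_pos | apply one_plus_sqr_pos].
  - replace (exp (- t ^ 2)) with (RInt (fun _ => exp (- t ^ 2)) 0 1)
      by (rewrite RInt_const; unfold scal; simpl; unfold mult; simpl; ring).
    apply RInt_le; [lra | auto | apply ex_RInt_const |]; intros y _.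
    assert (H := pow2_ge_0 y); assert (H' := pow2_ge_0 t).
    apply Rle_trans with (exp (- t ^ 2) / 1).
    + apply Rmult_le_compat.
      * left; apply exp_pos.
      * left; apply Rinv_0_lt_compat; lra.
      * apply exp_le_compat; nra.
      * apply Rinv_le_contravar; lra.
    + lra.
Qed.

Lemma is_lim_gauss : is_lim gauss p_infty (sqrt PI / 2).
Proof.
  assert (HPI := PI_RGT_0); assert (Hs := sqrt_lt_R0 PI HPI).
  assert (Haux : is_lim gauss_aux p_infty 0).
  { apply (is_lim_le_le_loc (fun _ => 0) (fun t => 1 * exp (- (1 * t))) _ p_infty 0).
    - exists 1; intros t Ht; destruct (gauss_aux_bound t) as [H1 H2]; split; auto.
      apply Rle_trans with (1 := H2); rewrite Rmult_1_l; apply exp_le_compat; nra.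
    - apply is_lim_const.
    - apply is_lim_exp_opp; lra. }
  apply (is_lim_ext_loc (fun t => sqrt (PI / 4 - gauss_aux t))).
  { exists 0; intros t Ht; rewrite <- gauss_sqr; apply sqrt_pow2, gauss_pos; lra. }
  replace (sqrt PI / 2) with (sqrt (PI / 4 - 0)).
  2:{ apply sqrt_lem_1; [lra|lra|].
      replace (sqrt PI / 2 * (sqrt PI / 2)) with (sqrt PI * sqrt PI / 4) by field.
      rewrite sqrt_sqrt; lra. }
  assert (H : is_lim (fun t => PI / 4 - gauss_aux t) p_infty (PI / 4 - 0)).
  { apply (is_lim_minus (fun _ => PI / 4) gauss_aux p_infty (PI / 4) 0);
      [apply is_lim_const | exact Haux | reflexivity]. }
  apply (filterlim_comp _ _ _ (fun t => PI / 4 - gauss_aux t) sqrt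
           (Rbar_locally' p_infty) (locally (PI / 4 - 0))).
  - exact H.
  - apply continuity_pt_filterlim, continuity_pt_sqrt; lra.
Qed.

(** The values of Gamma at n + 1/2, through Gamma(a + 1) = a Gamma(a). *)
Fixpoint half_gamma (n : nat) : R :=
  match n with
  | O => sqrt PI
  | S n => (INR n + 1 / 2) * half_gamma n
  end.

Lemma half_gamma_pos (n : nat) : 0 < half_gamma n.
Proof.
  induction n as [|n IH]; simpl.
  - apply sqrt_lt_R0, PI_RGT_0.
  - apply Rmult_lt_0_compat; auto; generalize (pos_INR n); lra.
Qed.

(** Legendre's duplication formula at half integers; it turns the Gamma quotients of the Struve
    series into the factorials of the sine and cosine series. *)
Lemma half_gamma_fact (n : nat) :
  half_gamma n * INR (fact n) * 4 ^ n = sqrt PI * INR (fact (2 * n)).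
Proof.
  induction n as [|n IH]; [simpl; ring|].
  replace (2 * S n)%nat with (S (S (2 * n))) by lia.
  rewrite !fact_simpl, !mult_INR, !S_INR, mult_INR; simpl half_gamma; simpl pow.
  transitivity ((INR n + 1 / 2) * (INR n + 1) * 4 *
                (half_gamma n * INR (fact n) * 4 ^ n)); [ring|].
  rewrite IH; simpl (INR 2); field.
Qed.

Lemma is_derive_Rpower (a t : R) : 0 < t ->
  is_derive (fun t => Rpower t a) t (a * Rpower t (a - 1)).
Proof. intros Ht; apply is_derive_Reals, derivable_pt_lim_power; auto. Qed.

Lemma filterlim_at_right_continuous (f : R -> R) (t : R) :
  continuous f t -> filterlim f (at_right t) (locally (f t)).
Proof.
  intros Hf; apply filterlim_filter_le_1 with (2 := Hf); apply filter_le_within.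
Qed.

Lemma filterlim_sqrt_0 : filterlim sqrt (at_right 0) (locally 0).
Proof.
  generalize (filterlim_at_right_continuous sqrt 0); rewrite sqrt_0.
  intros H; apply H; clear H.
  apply continuity_pt_filterlim, continuity_pt_sqrt; lra.
Qed.

Lemma filterlim_Rpower_0 (a : R) : 1 / 2 <= a ->
  filterlim (fun t => Rpower t a) (at_right 0) (locally 0).
Proof.
  intros Ha.
  apply (filterlim_le_le (F := at_right 0) (fun _ => 0) _ sqrt 0).
  - unfold at_right, within.
    exists (mkposreal 1 Rlt_0_1); intros t Ht Hpos.
    assert (Ht1 : t < 1).
    { unfold ball in Ht; simpl in Ht; unfold AbsRing_ball, abs, minus, plus, opp in Ht;
        simpl in Ht; apply Rabs_def2 in Ht; lra. }
    split; [left; apply exp_pos|].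
    rewrite <- Rpower_sqrt by auto; unfold Rpower; apply exp_le_compat.
    assert (ln t < 0) by (rewrite <- ln_1; apply ln_increasing; auto).
    nra.
  - apply filterlim_const.
  - apply filterlim_sqrt_0.
Qed.

Lemma is_lim_Rpower_exp (n : nat) :
  is_lim (fun t => Rpower t (INR n + 1 / 2) * exp (- t)) p_infty 0.
Proof.
  set (K := (/ (1 / 2)) ^ (S n) * INR (fact (S n))).
  apply (is_lim_le_le_loc (fun _ => 0) (fun t => K * exp (- (1 / 2 * t))) _ p_infty 0).
  - exists 1; intros t Ht; split.
    + left; apply Rmult_lt_0_compat; apply exp_pos.
    + apply Rle_trans with (t ^ S n * exp (- t)).
      * apply Rmult_le_compat_r; [left; apply exp_pos|].
        rewrite <- Rpower_pow by lra; apply Rle_Rpower; [lra|].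
        rewrite S_INR; lra.
      * apply Rle_trans with (K * exp (1 / 2 * t) * exp (- t)).
        -- apply Rmult_le_compat_r; [left; apply exp_pos|].
           apply pow_le_exp; lra.
        -- rewrite Rmult_assoc, <- exp_plus; right; do 2 f_equal; field.
  - apply is_lim_const.
  - apply is_lim_exp_opp; lra.
Qed.

(** The induction carries a primitive rather than an integral. The base case is the substitution t =
    s^2 in the Gaussian, the step is integration by parts, and the boundary terms vanish at both
    ends. *)
Lemma Gamma_primitive (n : nat) : exists G : R -> R,
  (forall t, 0 < t -> is_derive G t (Rpower t (INR n + 1 / 2 - 1) * exp (- t))) /\
  filterlim G (at_right 0) (locally 0) /\ is_lim G p_infty (half_gamma n).
Proof.
  induction n as [|n [G [HG [H0 Hi]]]].
  - exists (fun t => 2 * gauss (sqrt t)); split; [|split].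
    + intros t Ht.
      assert (Hs := sqrt_lt_R0 t Ht).
      apply (is_derive_eq _ _ (2 * (/ (2 * sqrt t) * exp (- sqrt t ^ 2)))).
      * apply (is_derive_scal (fun t => gauss (sqrt t))).
        apply (is_derive_comp gauss sqrt); [apply is_derive_gauss|].
        apply is_derive_Reals, derivable_pt_lim_sqrt; auto.
      * replace (INR 0 + 1 / 2 - 1) with (- (/ 2)) by (simpl; field).
        rewrite Rpower_Ropp, Rpower_sqrt, pow2_sqrt by lra; field; lra.
    + replace (locally 0) with (locally (2 * gauss 0))
        by (rewrite gauss_0; f_equal; ring).
      apply (filterlim_comp _ _ _ sqrt (fun s => 2 * gauss s) _ (locally 0)).
      * apply filterlim_sqrt_0.
      * apply (ex_derive_continuous (fun s => 2 * gauss s)).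
        eexists; apply (is_derive_scal gauss), is_derive_gauss.
    + simpl half_gamma; replace (sqrt PI) with (2 * (sqrt PI / 2)) by field.
      apply (is_lim_scal_l (fun t => gauss (sqrt t)) 2 p_infty (sqrt PI / 2)).
      apply (is_lim_comp gauss sqrt p_infty (sqrt PI / 2) p_infty).
      * apply is_lim_gauss.
      * apply (is_lim_sqrt_p (fun t => t)), is_lim_id.
      * exists 0; intros; discriminate.
  - exists (fun t => (INR n + 1 / 2) * G t - Rpower t (INR n + 1 / 2) * exp (- t)).
    assert (Hn := pos_INR n); split; [|split].
    + intros t Ht.
      replace (INR (S n) + 1 / 2 - 1) with (INR n + 1 / 2) by (rewrite S_INR; ring).
      assert (H1 := is_derive_Rpower (INR n + 1 / 2) t Ht).
      assert (H2 : is_derive (fun t => exp (- t)) t (- exp (- t)))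
        by (auto_derive; auto; ring).
      apply (is_derive_eq _ _ _ _ (is_derive_minus _ _ _ _ _
        (is_derive_scal G t (INR n + 1 / 2) _ (HG t Ht))
        (is_derive_mult _ _ _ _ _ H1 H2 Rmult_comm))).
      unfold minus, plus, opp, scal, mult; simpl; unfold mult; simpl.
      ring.
    + replace 0 with ((INR n + 1 / 2) * 0 - 0 * 1) at 2 by ring.
      apply (filterlim_comp_2 (F := at_right 0)
        (G := locally ((INR n + 1 / 2) * 0)) (H := locally (- (0 * 1)))
        (fun t => (INR n + 1 / 2) * G t)
        (fun t => - (Rpower t (INR n + 1 / 2) * exp (- t))) Rplus).
      * apply (filterlim_comp _ _ _ G (fun y => (INR n + 1 / 2) * y) _ (locally 0)); auto.
        apply (filterlim_scal_r (V := R_NormedModule) (INR n + 1 / 2) 0).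
      * apply (filterlim_comp _ _ _ (fun t => Rpower t (INR n + 1 / 2) * exp (- t)) Ropp
                 _ (locally (0 * 1))).
        -- apply (filterlim_comp_2 (F := at_right 0)
             (G := locally 0) (H := locally 1)
             (fun t => Rpower t (INR n + 1 / 2)) (fun t => exp (- t)) Rmult).
           ++ apply filterlim_Rpower_0; lra.
           ++ replace 1 with (exp (- 0)) by (rewrite Ropp_0; apply exp_0).
              apply (filterlim_at_right_continuous (fun t => exp (- t))).
              apply (ex_derive_continuous (fun t => exp (- t))).
              auto_derive; auto.
           ++ apply (filterlim_mult 0 1).
        -- apply (filterlim_opp (0 * 1)).
      * apply (filterlim_plus ((INR n + 1 / 2) * 0) (- (0 * 1))).
    + simpl half_gamma.
      replace ((INR n + 1 / 2) * half_gamma n) with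
        ((INR n + 1 / 2) * half_gamma n - 0) by ring.
      apply (is_lim_minus (fun t => (INR n + 1 / 2) * G t) _ p_infty
               ((INR n + 1 / 2) * half_gamma n) 0); [| |reflexivity].
      * apply (is_lim_scal_l G (INR n + 1 / 2) p_infty (half_gamma n)); auto.
      * apply is_lim_Rpower_exp.
Qed.

Lemma Gamma_half (n : nat) : Gamma (INR n + 1 / 2) = half_gamma n.
Proof.
  destruct (Gamma_primitive n) as [G [HG [H0 Hi]]].
  unfold Gamma; apply is_RInt_gen_unique.
  replace (half_gamma n) with (half_gamma n - 0) by ring.
  apply (is_RInt_gen_primitive _ _ _ G); auto.
  exists (fun t => 0 < t) (fun t => 1 < t).
  - unfold at_right, within; apply filter_forall; auto.
  - exists 1; auto.
  - intros u v Hu Hv t [Ht _]; simpl in Ht.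
    assert (Ht0 : 0 < t).
    { apply Rlt_le_trans with (2 := Ht); apply Rmin_glb_lt; lra. }
    split; [apply HG; auto|].
    match goal with |- continuous ?f _ => apply (ex_derive_continuous f) end.
    unfold Rpower; auto_derive; auto.
Qed.

Lemma pochhammer_half (m r : nat) :
  pochhammer (INR m + 1 / 2) r = half_gamma (m + r) / half_gamma m.
Proof.
  unfold pochhammer.
  replace (INR m + 1 / 2 + INR r) with (INR (m + r) + 1 / 2)
    by (rewrite plus_INR; ring).
  rewrite !Gamma_half; reflexivity.
Qed.

(** Half the Beta value B(p + 1/2, k + 1). *)
Lemma moment_half_pi (p k : nat) :
  is_RInt (fun v => sin v ^ (2 * p) * cos v ^ (2 * k + 1)) 0 (PI / 2)
    (half_gamma p * INR (fact k) / (2 * half_gamma (p + k + 1))).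
Proof.
  assert (Hp := pos_INR p).
  induction k as [|k IH].
  - replace (p + 0 + 1)%nat with (S p) by lia.
    assert (Hh := half_gamma_pos p).
    replace (half_gamma p * INR (fact 0) / (2 * half_gamma (S p))) with
      (/ (2 * INR p + 1) * sin (PI / 2) ^ S (2 * p)
       - / (2 * INR p + 1) * sin 0 ^ S (2 * p)).
    + apply (is_RInt_derive (fun v => / (2 * INR p + 1) * sin v ^ S (2 * p))).
      * intros v _.
        apply (is_derive_eq _ _ _ _ (is_derive_scal (fun v => sin v ^ S (2 * p)) v _ _
          (is_derive_pow sin (S (2 * p)) v (cos v)
             ltac:(apply is_derive_Reals, derivable_pt_lim_sin)))).
        rewrite S_INR, mult_INR; change (pred (S (2 * p))) with (2 * p)%nat; simpl (INR 2).
        rewrite Nat.mul_0_r; simpl (0 + 1)%nat.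
        field; lra.
      * intros v _.
        apply (ex_derive_continuous (fun v => sin v ^ (2 * p) * cos v ^ (2 * 0 + 1))).
        auto_derive; auto.
    + rewrite sin_PI2, sin_0, pow1, pow_i by lia; simpl half_gamma; simpl fact.
      simpl INR; field; split; lra.
  - assert (Hk := pos_INR k).
    (* Integrating the derivative of sin^(2p+1) cos^(2k+2) and replacing sin^2 by 1 - cos^2 gives d
       I(k+1) = (2k + 2) I(k), where d = (2p + 1) + (2k + 2). *)
    set (d := 2 * INR p + 2 * INR k + 3).
    assert (Hb : is_RInt (fun v => (2 * INR p + 1) * (sin v ^ (2 * p) * cos v ^ (2 * S k + 1))
               - (2 * INR k + 2) * (sin v ^ (2 * p + 2) * cos v ^ (2 * k + 1))) 0 (PI / 2)
             (sin (PI / 2) ^ S (2 * p) * cos (PI / 2) ^ S (2 * k + 1)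
              - sin 0 ^ S (2 * p) * cos 0 ^ S (2 * k + 1))).
    { apply (is_RInt_derive (fun v => sin v ^ S (2 * p) * cos v ^ S (2 * k + 1))).
      - intros v _.
        apply (is_derive_eq _ _ _ _ (is_derive_mult _ _ v _ _
          (is_derive_pow sin (S (2 * p)) v (cos v)
             ltac:(apply is_derive_Reals, derivable_pt_lim_sin))
          (is_derive_pow cos (S (2 * k + 1)) v (- sin v)
             ltac:(apply is_derive_Reals, derivable_pt_lim_cos)) Rmult_comm)).
        match goal with |- plus (mult ?a ?b) (mult ?c ?d) = ?e =>
          change (a * b + c * d = e) end.
        replace (2 * S k + 1)%nat with (S (S (2 * k + 1))) by lia.
        replace (2 * p + 2)%nat with (S (S (2 * p))) by lia.
        rewrite !S_INR, plus_INR, !mult_INR; simpl (INR 2); simpl (INR 1).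
        change (pred (S (2 * p))) with (2 * p)%nat.
        change (pred (S (2 * k + 1))) with (2 * k + 1)%nat.
        simpl pow; ring.
      - intros v _.
        match goal with |- continuous ?f _ => apply (ex_derive_continuous f) end.
        auto_derive; auto. }
    rewrite cos_PI2, sin_0, !pow_i in Hb by lia.
    replace (sin (PI / 2) ^ S (2 * p) * 0 - 0 * cos 0 ^ S (2 * k + 1)) with 0 in Hb by ring.
    assert (Hk' := is_RInt_scal _ _ _ ((2 * INR k + 2) / d) _ IH).
    assert (Hb' := is_RInt_scal _ _ _ (/ d) _ Hb).
    assert (H := is_RInt_plus _ _ _ _ _ _ Hb' Hk').
    replace (half_gamma p * INR (fact (S k)) / (2 * half_gamma (p + S k + 1))) with
      (/ d * 0 + (2 * INR k + 2) / d *
        (half_gamma p * INR (fact k) / (2 * half_gamma (p + k + 1)))).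
    2:{ replace (p + S k + 1)%nat with (S (p + k + 1)) by lia.
        simpl half_gamma; rewrite fact_simpl, mult_INR, S_INR, !plus_INR; simpl (INR 1).
        assert (Hh := half_gamma_pos (p + k + 1)); unfold d; field; repeat split; lra. }
    refine (is_RInt_ext _ _ _ _ _ _ H); intros v _.
    match goal with |- plus (scal ?a ?b) (scal ?c ?d) = ?e =>
      change (a * b + c * d = e) end.
    replace (2 * p + 2)%nat with (S (S (2 * p))) by lia.
    replace (2 * S k + 1)%nat with (S (S (2 * k + 1))) by lia.
    assert (E := sin2_cos2 v); unfold Rsqr in E.
    assert (E' : sin v ^ S (S (2 * p)) = sin v ^ (2 * p) * (1 - cos v ^ 2)).
    { replace (1 - cos v ^ 2) with (sin v * sin v) by lra; simpl pow; ring. }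
    rewrite E'; unfold d; simpl pow; field; lra.
Qed.

(** * The Struve series *)

Lemma is_series_tail_le (a M : nat -> R) (l : R) (N : nat) :
  is_series a l -> ex_series M -> (forall k, Rabs (a k) <= M k) ->
  Rabs (l - sum_n a N) <= Series M - sum_n M N.
Proof.
  intros Ha HM Hle.
  assert (Ha' : is_lim_seq (fun K => Rabs (sum_n a K - sum_n a N)) (Rabs (l - sum_n a N))).
  { apply (is_lim_seq_abs _ (l - sum_n a N)).
    apply (is_lim_seq_minus _ _ l (sum_n a N)); [exact Ha | apply is_lim_seq_const|].
    reflexivity. }
  assert (HM' : is_lim_seq (fun K => sum_n M K - sum_n M N) (Series M - sum_n M N)).
  { apply (is_lim_seq_minus _ _ (Series M) (sum_n M N));
      [exact (Series_correct M HM) | apply is_lim_seq_const | reflexivity]. }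
  enough (H : Rbar_le (Rabs (l - sum_n a N)) (Series M - sum_n M N)) by exact H.
  apply (is_lim_seq_le_loc _ _ _ _ ) with (2 := Ha') (3 := HM').
  exists N; intros K HK.
  induction HK as [|K HK IH].
  - rewrite !Rminus_diag, Rabs_R0; lra.
  - rewrite !sum_Sn; unfold plus; simpl.
    replace (sum_n a K + a (S K) - sum_n a N) with
      ((sum_n a K - sum_n a N) + a (S K)) by ring.
    apply Rle_trans with (1 := Rabs_triang _ _); generalize (Hle (S K)); lra.
Qed.

Lemma is_RInt_sum_n (f : nat -> R -> R) (I : nat -> R) (a b : R) (N : nat) :
  (forall k, is_RInt (f k) a b (I k)) ->
  is_RInt (fun t => sum_n (fun k => f k t) N) a b (sum_n I N).
Proof.
  intros H; induction N as [|N IH].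
  - rewrite sum_O; apply (is_RInt_ext (f O)); [|apply H].
    intros t _; rewrite sum_O; auto.
  - rewrite sum_Sn.
    apply (is_RInt_ext (fun t => plus (sum_n (fun k => f k t) N) (f (S N) t))).
    + intros t _; rewrite sum_Sn; auto.
    + apply (is_RInt_plus (V := R_NormedModule)); auto.
Qed.

(** Weierstrass M-test: the remainder of the integrand is at most a tail of [M] uniformly in [t], so
    the integrals differ by at most b - a times that tail. *)
Lemma is_series_RInt (f : nat -> R -> R) (S : R -> R) (I M : nat -> R) (a b L : R) :
  a <= b -> (forall k, is_RInt (f k) a b (I k)) -> is_RInt S a b L ->
  (forall t, a <= t <= b -> is_series (fun k => f k t) (S t)) ->
  (forall k t, a <= t <= b -> Rabs (f k t) <= M k) -> ex_series M ->
  is_series I L.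
Proof.
  intros Hab Hf HS Hs Hle HM.
  assert (Hbound : forall N, Rabs (sum_n I N - L) <= (b - a) * (Series M - sum_n M N)).
  { intros N; rewrite <- Rabs_Ropp, Ropp_minus_distr.
    assert (H := is_RInt_minus _ _ _ _ _ _ HS (is_RInt_sum_n f I a b N Hf)).
    apply (is_RInt_unique (V := R_CompleteNormedModule)) in H as E.
    change (Rabs (minus L (sum_n I N) : R) <= (b - a) * (Series M - sum_n M N)).
    eapply Rle_trans; [right; apply (f_equal Rabs); symmetry; exact E|].
    apply abs_RInt_le_const; auto.
    - eexists; exact H.
    - intros t Ht; apply (is_series_tail_le (fun k => f k t)); auto. }
  assert (Hz : is_lim_seq (fun N => (b - a) * (Series M - sum_n M N)) 0).
  { replace (Finite 0) with (Rbar_mult (b - a) (Series M - Series M))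
      by (simpl; f_equal; ring).
    apply (is_lim_seq_scal_l _ (b - a) (Series M - Series M)).
    apply (is_lim_seq_minus _ _ (Series M) (Series M));
      [apply is_lim_seq_const | exact (Series_correct M HM) | reflexivity]. }
  assert (Hd : is_lim_seq (fun N => sum_n I N - L) 0).
  { apply is_lim_seq_abs_0.
    apply (is_lim_seq_le_le (fun _ => 0) _ _ 0) with (3 := Hz).
    - intros N; split; [apply Rabs_pos | apply Hbound].
    - apply is_lim_seq_const. }
  assert (HL : is_lim_seq (fun N => (sum_n I N - L) + L) (0 + L)).
  { apply (is_lim_seq_plus _ _ 0 L); [exact Hd | apply is_lim_seq_const | reflexivity]. }
  rewrite Rplus_0_l in HL.
  apply (is_lim_seq_ext (fun N => (sum_n I N - L) + L) (sum_n I)) in HL; [exact HL|].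
  intros N; ring.
Qed.

Lemma is_series_exp (y : R) : is_series (fun k => y ^ k / INR (fact k)) (exp y).
Proof.
  apply is_series_Reals; unfold exp.
  destruct (exist_exp y) as [l Hl]; simpl.
  intros e He; destruct (Hl e He) as [N HN]; exists N; intros n Hn.
  rewrite (sum_eq _ (fun i => / INR (fact i) * y ^ i)); [apply HN; auto|].
  intros i _; unfold Rdiv; ring.
Qed.

Lemma is_series_sin (z : R) :
  is_series (fun k => (-1) ^ k / INR (fact (2 * k + 1)) * z ^ (2 * k + 1)) (sin z).
Proof.
  unfold sin; destruct (exist_sin z²) as [l Hl].
  apply (is_series_ext (fun k => scal z (sin_n k * z² ^ k))).
  - intros k; change (scal z (sin_n k * z² ^ k)) with (z * (sin_n k * z² ^ k)).
    replace (z ^ (2 * k + 1)) with (z * (z ^ 2) ^ k)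
      by (rewrite pow_add, pow_mult, pow_1; ring).
    rewrite Rsqr_pow2; unfold sin_n; simpl; ring.
  - apply (is_series_scal (V := R_NormedModule) z), is_series_Reals, Hl.
Qed.

Lemma is_series_cos (z : R) :
  is_series (fun k => (-1) ^ k / INR (fact (2 * k)) * z ^ (2 * k)) (cos z).
Proof.
  unfold cos; destruct (exist_cos z²) as [l Hl].
  apply (is_series_ext (fun k => cos_n k * z² ^ k)).
  - intros k; unfold cos_n; rewrite pow_mult, Rsqr_pow2; reflexivity.
  - apply is_series_Reals, Hl.
Qed.

(** A summable majorant for the cosine series ([j = 0]) and the sine series ([j = 1]), from (2k +
    j)! >= k!. *)
Lemma pow_fact_even_le (y z : R) (k j : nat) : (j <= 1)%nat -> Rabs z <= y ->
  Rabs ((-1) ^ k / INR (fact (2 * k + j)) * z ^ (2 * k + j))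
  <= y ^ j * ((y ^ 2) ^ k / INR (fact k)).
Proof.
  intros Hj Hz.
  assert (Hy : 0 <= y) by (generalize (Rabs_pos z); lra).
  unfold Rdiv; rewrite !Rabs_mult, <- !RPow_abs.
  replace (Rabs (-1)) with 1 by (rewrite Rabs_left; lra); rewrite pow1, Rmult_1_l.
  rewrite (Rabs_pos_eq (/ _)) by (left; apply Rinv_0_lt_compat, INR_fact_lt_0).
  rewrite <- pow_mult, (Rmult_comm (y ^ (2 * k))), <- Rmult_assoc, (Rmult_comm (y ^ j)).
  rewrite Rmult_assoc, <- pow_add, (Nat.add_comm j).
  apply Rmult_le_compat.
  - left; apply Rinv_0_lt_compat, INR_fact_lt_0.
  - apply pow_le, Rabs_pos.
  - apply Rinv_le_contravar; [apply INR_fact_lt_0|].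
    apply le_INR, fact_le; lia.
  - apply pow_incr; split; [apply Rabs_pos | auto].
Qed.

Lemma pow_sin_le_1 (v : R) (p : nat) : Rabs (sin v ^ p) <= 1.
Proof.
  rewrite <- RPow_abs, <- (pow1 p); apply pow_incr.
  split; [apply Rabs_pos | apply Rabs_sin_le_1].
Qed.

Lemma Rabs_mult_le_1 (y z : R) : Rabs z <= 1 -> Rabs (y * z) <= Rabs y.
Proof. intros H; rewrite Rabs_mult; generalize (Rabs_pos y); nra. Qed.

Lemma Rabs_cos_le_1 (t : R) : Rabs (cos t) <= 1.
Proof. apply Rabs_le, COS_bound. Qed.

Lemma struve_moment_series (p : nat) (y : R) :
  is_series (fun k => (-1) ^ k / INR (fact (2 * k + 1)) * y ^ (2 * k + 1)
      * (half_gamma p * INR (fact k) / (2 * half_gamma (p + k + 1))))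
    (RInt (fun v => sin v ^ (2 * p) * sin (y * cos v)) 0 (PI / 2)).
Proof.
  assert (HPI := PI_RGT_0).
  apply (is_series_RInt
    (fun k v => sin v ^ (2 * p) *
       ((-1) ^ k / INR (fact (2 * k + 1)) * (y * cos v) ^ (2 * k + 1)))
    (fun v => sin v ^ (2 * p) * sin (y * cos v)) _
    (fun k => Rabs y ^ 1 * ((Rabs y ^ 2) ^ k / INR (fact k))) 0 (PI / 2)).
  - lra.
  - intros k.
    assert (H := is_RInt_scal (V := R_NormedModule) _ _ _
      ((-1) ^ k / INR (fact (2 * k + 1)) * y ^ (2 * k + 1)) _ (moment_half_pi p k)).
    refine (is_RInt_ext _ _ _ _ _ _ H); intros v _.
    rewrite Rpow_mult_distr.
    match goal with |- scal ?a ?b = ?c => change (a * b = c) end; ring.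
  - apply (RInt_correct (V := R_CompleteNormedModule)), ex_RInt_derivable.
    intros v; auto_derive; auto.
  - intros v _; apply (is_series_scal (V := R_NormedModule) (sin v ^ (2 * p))).
    apply is_series_sin.
  - intros k v _; rewrite Rabs_mult.
    rewrite <- (Rmult_1_l (Rabs y ^ 1 * _)).
    apply Rmult_le_compat; try apply Rabs_pos.
    + apply pow_sin_le_1.
    + apply (pow_fact_even_le (Rabs y) (y * cos v) k 1); auto.
      apply Rabs_mult_le_1, Rabs_cos_le_1.
  - apply (ex_series_scal (V := R_NormedModule) (Rabs y ^ 1)).
    eexists; apply is_series_exp.
Qed.

(** Poisson's integral for the Struve function of integer order: expand the sine, integrate termwise
    with the Beta moments, and apply duplication. *)
Lemma scaled_struve_integral (p : nat) (y : R) :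
  scaled_struve (INR p) y =
    2 / (sqrt PI * half_gamma p)
    * RInt (fun v => sin v ^ (2 * p) * sin (y * cos v)) 0 (PI / 2).
Proof.
  assert (Hs := sqrt_lt_R0 PI PI_RGT_0).
  unfold scaled_struve; apply is_series_unique.
  apply (is_series_ext (fun k => scal (2 / (sqrt PI * half_gamma p))
    ((-1) ^ k / INR (fact (2 * k + 1)) * y ^ (2 * k + 1)
      * (half_gamma p * INR (fact k) / (2 * half_gamma (p + k + 1)))))).
  - intros k.
    replace (INR k + 3 / 2) with (INR (S k) + 1 / 2) by (rewrite S_INR; field).
    replace (INR k + INR p + 3 / 2) with (INR (p + k + 1) + 1 / 2)
      by (rewrite !plus_INR; simpl (INR 1); field).
    rewrite !Gamma_half.
    assert (H := half_gamma_fact k); simpl half_gamma.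
    assert (H1 := half_gamma_pos p); assert (H2 := half_gamma_pos k).
    assert (H3 := half_gamma_pos (p + k + 1)); assert (H4 := INR_fact_lt_0 k).
    assert (H5 := INR_fact_lt_0 (2 * k)); assert (H6 := pos_INR k).
    replace (2 * k + 1)%nat with (S (2 * k)) by lia.
    rewrite fact_simpl, mult_INR, S_INR, mult_INR; simpl (INR 2).
    unfold Rdiv.
    rewrite (Rpow_mult_distr y); rewrite (pow_inv 2).
    change (2 ^ S (2 * k)) with (2 * 2 ^ (2 * k)).
    rewrite (pow_mult 2 2 k); replace (2 ^ 2) with 4 by ring.
    assert (H7 : 0 < 4 ^ k) by (apply pow_lt; lra).
    match goal with |- scal ?a ?b = ?c => change (a * b = c) end.
    apply Rmult_eq_reg_r with (half_gamma k * INR (fact k) * 4 ^ k);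
      [|apply Rgt_not_eq; repeat apply Rmult_lt_0_compat; auto].
    rewrite H at 1.
    field; repeat split; lra.
  - apply (is_series_scal (V := R_NormedModule)), struve_moment_series.
Qed.

Definition struve_density (x al : R) (r : nat) (v : R) : R :=
  sin v ^ (2 * r) * (cos (x * sin (al / 2) * sin v) * sin (x * cos (al / 2) * cos v)).

(** After Poisson's integral is inserted, the Pochhammer symbol cancels Gamma(m + r + 1/2), and
    duplication merges m! and Gamma(m + 1/2) into (2m)!. The sum over [m] is then a cosine series
    under the integral. *)
Lemma is_series_struve_term (x al : R) (r : nat) :
  is_series (struve_term x al r)
    (2 / PI * RInt (struve_density x al r) 0 (PI / 2)).
Proof.
  assert (HPI := PI_RGT_0).
  set (s := sin (al / 2)); set (c := cos (al / 2)).
  apply (is_series_ext (fun m => scal (2 / PI)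
    ((-1) ^ m / INR (fact (2 * m)) * (x * s) ^ (2 * m) *
     RInt (fun v => sin v ^ (2 * (m + r)) * sin (x * c * cos v)) 0 (PI / 2)))).
  - intros m; unfold struve_term; fold s c.
    rewrite pochhammer_half, scaled_struve_integral.
    match goal with |- scal ?a (_ * ?b) = _ =>
      match b with RInt _ _ _ => set (I := b) end end.
    match goal with |- scal ?a ?b = ?c => change (a * b = c) end.
    assert (Hs := sqrt_lt_R0 PI HPI).
    assert (H := half_gamma_fact m).
    assert (H1 := half_gamma_pos m); assert (H2 := half_gamma_pos (m + r)).
    assert (H4 := INR_fact_lt_0 m); assert (H5 := INR_fact_lt_0 (2 * m)).
    assert (H7 : 0 < 4 ^ m) by (apply pow_lt; lra).
    unfold Rdiv; rewrite (Rpow_mult_distr (x * s)), (pow_inv 2).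
    rewrite (pow_mult 2 2 m); replace (2 ^ 2) with 4 by ring.
    apply Rmult_eq_reg_r with (half_gamma m * INR (fact m) * 4 ^ m);
      [|apply Rgt_not_eq; repeat apply Rmult_lt_0_compat; auto].
    rewrite H at 1; rewrite <- (sqrt_sqrt PI) at 1 by lra.
    field; repeat split; lra.
  - apply (is_series_scal (V := R_NormedModule) (2 / PI)).
    apply (is_series_RInt
      (fun m v => sin v ^ (2 * r) * sin (x * c * cos v) *
         ((-1) ^ m / INR (fact (2 * m + 0)) * (x * s * sin v) ^ (2 * m + 0)))
      (struve_density x al r) _
      (fun m => Rabs (x * s) ^ 0 * ((Rabs (x * s) ^ 2) ^ m / INR (fact m))) 0 (PI / 2)).
    + lra.
    + intros m; rewrite Nat.add_0_r.
      assert (H : is_RInt (fun v => sin v ^ (2 * (m + r)) * sin (x * c * cos v)) 0 (PI / 2)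
        (RInt (fun v => sin v ^ (2 * (m + r)) * sin (x * c * cos v)) 0 (PI / 2))).
      { apply (RInt_correct (V := R_CompleteNormedModule)), ex_RInt_derivable.
        intros v; auto_derive; auto. }
      apply (is_RInt_scal (V := R_NormedModule) _ _ _
        ((-1) ^ m / INR (fact (2 * m)) * (x * s) ^ (2 * m))) in H.
      refine (is_RInt_ext _ _ _ _ _ _ H); intros v _.
      match goal with |- scal ?a ?b = ?c => change (a * b = c) end.
      rewrite Nat.mul_add_distr_l, pow_add, (Rpow_mult_distr (x * s)); ring.
    + apply (RInt_correct (V := R_CompleteNormedModule)), ex_RInt_derivable.
      intros v; unfold struve_density; auto_derive; auto.
    + intros v _; unfold struve_density; fold s c.
      replace (sin v ^ (2 * r) * (cos (x * s * sin v) * sin (x * c * cos v))) with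
        (sin v ^ (2 * r) * sin (x * c * cos v) * cos (x * s * sin v)) by ring.
      apply (is_series_scal (V := R_NormedModule) (sin v ^ (2 * r) * sin (x * c * cos v))).
      apply (is_series_ext (fun k => (-1) ^ k / INR (fact (2 * k)) * (x * s * sin v) ^ (2 * k)));
        [intros k; rewrite Nat.add_0_r; auto | apply is_series_cos].
    + intros m v _; rewrite Rabs_mult.
      rewrite <- (Rmult_1_l (Rabs (x * s) ^ 0 * _)).
      apply Rmult_le_compat; try apply Rabs_pos.
      * rewrite <- (Rmult_1_l 1), Rabs_mult.
        apply Rmult_le_compat; try apply Rabs_pos; [apply pow_sin_le_1 | apply Rabs_sin_le_1].
      * apply (pow_fact_even_le (Rabs (x * s)) (x * s * sin v) m 0); auto.
        apply Rabs_mult_le_1, Rabs_sin_le_1.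
    + apply (ex_series_scal (V := R_NormedModule) (Rabs (x * s) ^ 0)).
      eexists; apply is_series_exp.
Qed.

(** The factors sin(v)^(2r) left by the inner sums assemble into the exponential series of rho
    sin(v)^2. *)
Lemma is_series_struve (x rho al : R) :
  is_series (fun r => rho ^ r / INR (fact r) * Series (struve_term x al r))
    (2 / PI * RInt (fun v => exp (rho * sin v ^ 2) *
       (sin (x * cos (al / 2) * cos v) * cos (x * sin (al / 2) * sin v))) 0 (PI / 2)).
Proof.
  assert (HPI := PI_RGT_0).
  apply (is_series_ext (fun r => scal (2 / PI)
    (rho ^ r / INR (fact r) * RInt (struve_density x al r) 0 (PI / 2)))).
  - intros r; rewrite (is_series_unique _ _ (is_series_struve_term x al r)).
    match goal with |- scal ?a ?b = ?c => change (a * b = c) end; ring.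
  - apply (is_series_scal (V := R_NormedModule) (2 / PI)).
    apply (is_series_RInt
      (fun r v => rho ^ r / INR (fact r) * struve_density x al r v)
      (fun v => exp (rho * sin v ^ 2) *
       (sin (x * cos (al / 2) * cos v) * cos (x * sin (al / 2) * sin v))) _
      (fun r => Rabs rho ^ r / INR (fact r)) 0 (PI / 2)).
    + lra.
    + intros r; apply (is_RInt_scal (V := R_NormedModule) (struve_density x al r)).
      apply (RInt_correct (V := R_CompleteNormedModule)), ex_RInt_derivable.
      intros v; unfold struve_density; auto_derive; auto.
    + apply (RInt_correct (V := R_CompleteNormedModule)), ex_RInt_derivable.
      intros v; auto_derive; auto.
    + intros v _; unfold struve_density.
      set (q := sin _ * cos _).
      apply (is_series_ext (fun r => scal q ((rho * sin v ^ 2) ^ r / INR (fact r)))).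
      * intros r; match goal with |- scal ?a ?b = ?c => change (a * b = c) end.
        unfold q; rewrite Rpow_mult_distr, pow_mult; unfold Rdiv; ring.
      * rewrite (Rmult_comm (exp _)).
        apply (is_series_scal (V := R_NormedModule) q), is_series_exp.
    + intros r v _; unfold Rdiv; rewrite !Rabs_mult, <- RPow_abs.
      rewrite (Rabs_pos_eq (/ _)) by (left; apply Rinv_0_lt_compat, INR_fact_lt_0).
      rewrite <- (Rmult_1_r (Rabs rho ^ r * _)) at 2.
      apply Rmult_le_compat_l.
      * apply Rmult_le_pos; [apply pow_le, Rabs_pos|].
        left; apply Rinv_0_lt_compat, INR_fact_lt_0.
      * unfold struve_density; rewrite !Rabs_mult.
        rewrite <- (Rmult_1_l 1); apply Rmult_le_compat;
          [apply Rabs_pos | apply Rmult_le_pos; apply Rabs_pos | apply pow_sin_le_1 |].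
        rewrite <- (Rmult_1_l 1); apply Rmult_le_compat; try apply Rabs_pos;
          [apply Rabs_cos_le_1 | apply Rabs_sin_le_1].
    + eexists; apply is_series_exp.
Qed.

(** * The Laplace integral *)

Lemma is_derive_exp_partial_sum (N : nat) (z : R) :
  is_derive (fun z => sum_n (fun k => z ^ k / INR (fact k)) (S N)) z
    (sum_n (fun k => z ^ k / INR (fact k)) N).
Proof.
  induction N as [|N IH].
  - apply (is_derive_ext (fun z => 1 + z)).
    + intros t; rewrite sum_Sn, sum_O; unfold plus; simpl; field.
    + rewrite sum_O; simpl; auto_derive; auto; field.
  - apply (is_derive_ext (fun z => plus (sum_n (fun k => z ^ k / INR (fact k)) (S N))
             (z ^ (S (S N)) / INR (fact (S (S N)))))).
    { intros t; rewrite (sum_Sn _ (S N)); reflexivity. }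
    rewrite (sum_Sn _ N).
    apply (is_derive_plus (fun z => sum_n (fun k => z ^ k / INR (fact k)) (S N))
             (fun z => z ^ (S (S N)) / INR (fact (S (S N))))); auto.
    assert (H1 := INR_fact_neq_0 (S N)); assert (H2 := pos_INR (S N)).
    apply (is_derive_ext (fun z => / INR (fact (S (S N))) * z ^ S (S N))).
    { intros t; unfold Rdiv; rewrite Rmult_comm; auto. }
    apply (is_derive_eq _ _ _ _ (is_derive_scal (fun z => z ^ S (S N)) z _ _
      (is_derive_pow (fun z => z) (S (S N)) z 1 (is_derive_id (K := R_AbsRing) z)))).
    rewrite (fact_simpl (S N)), mult_INR, (S_INR (S N)).
    change (pred (S (S N))) with (S N); field; split; lra.
Qed.

(** The derivative of each remainder is the previous one, so both inequalities propagate by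
    induction from equality at 0. *)
Lemma exp_taylor_remainder (N : nat) (z : R) : 0 <= z ->
  0 <= exp z - sum_n (fun k => z ^ k / INR (fact k)) N
    <= z ^ S N / INR (fact (S N)) * exp z.
Proof.
  revert z; induction N as [|N IH]; intros z Hz.
  - rewrite sum_O; simpl; generalize (exp_ineq1_le z); intros H.
    split; [lra|].
    enough (0 * exp 0 - exp 0 <= z * exp z - exp z) by (rewrite exp_0 in *; lra).
    apply (derive_nonneg_le (fun z => z * exp z - exp z) (fun z => z * exp z)); auto.
    + intros t _; auto_derive; auto; ring.
    + intros t Ht; apply Rmult_le_pos; [lra | left; apply exp_pos].
  - set (P := fun z => sum_n (fun k => z ^ k / INR (fact k)) (S N)).
    assert (HP0 : P 0 = 1).
    { unfold P; clear; induction N as [|N IH].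
      - rewrite sum_Sn, sum_O; unfold plus; simpl; field.
      - rewrite sum_Sn, IH, pow_i by lia; unfold plus; simpl plus.
        unfold Rdiv; change (1 + 0 * / INR (fact (S (S N))) = 1); ring. }
    assert (Hd : forall t, is_derive (fun t => exp t - P t) t
              (exp t - sum_n (fun k => t ^ k / INR (fact k)) N)).
    { intros t; apply (is_derive_minus exp P); [auto_derive; auto; ring|].
      apply is_derive_exp_partial_sum. }
    set (a := INR (fact (S (S N)))).
    assert (Ha : 0 < a) by apply INR_fact_lt_0.
    assert (Ea : a = (INR (S N) + 1) * INR (fact (S N)))
      by (unfold a; rewrite fact_simpl, mult_INR, (S_INR (S N)); auto).
    split.
    + enough (exp 0 - P 0 <= exp z - P z) by (rewrite exp_0, HP0 in *; unfold P in *; lra).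
      apply (derive_nonneg_le (fun t => exp t - P t)
               (fun t => exp t - sum_n (fun k => t ^ k / INR (fact k)) N)); auto.
      intros t Ht; apply IH; lra.
    + enough (0 ^ S (S N) / a * exp 0 - (exp 0 - P 0)
              <= z ^ S (S N) / a * exp z - (exp z - P z)).
      { rewrite exp_0, HP0, pow_i in H by lia; unfold P, Rdiv in *; lra. }
      apply (derive_nonneg_le (fun t => t ^ S (S N) / a * exp t - (exp t - P t))
        (fun t => (t ^ S N / INR (fact (S N)) + t ^ S (S N) / a) * exp t
                  - (exp t - sum_n (fun k => t ^ k / INR (fact k)) N))); auto.
      * intros t _; apply (is_derive_minus (fun t => t ^ S (S N) / a * exp t)
                             (fun t => exp t - P t)); auto.
        apply (is_derive_ext (fun t => (/ a * t ^ S (S N)) * exp t)).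
        { intros y; unfold Rdiv; rewrite (Rmult_comm (/ a)); auto. }
        assert (He : is_derive exp t (exp t)) by (auto_derive; auto; ring).
        apply (is_derive_eq _ _ _ _ (is_derive_mult (fun t => / a * t ^ S (S N)) exp t _ _
          (is_derive_scal (fun z => z ^ S (S N)) t _ _
            (is_derive_pow (fun z => z) (S (S N)) t 1 (is_derive_id (K := R_AbsRing) t)))
          He Rmult_comm)).
        match goal with |- plus (mult ?a ?b) (mult ?c ?d) = ?e =>
          change (a * b + c * d = e) end.
        assert (H1 := INR_fact_neq_0 (S N)); assert (H2 := pos_INR (S N)).
        rewrite Ea, (S_INR (S N)); change (pred (S (S N))) with (S N).
        field; split; lra.
      * intros t Ht; generalize (IH t ltac:(lra)); intros [_ H].
        assert (0 <= t ^ S (S N) / a * exp t).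
        { apply Rmult_le_pos; [|left; apply exp_pos].
          apply Rmult_le_pos; [apply pow_le; lra | left; apply Rinv_0_lt_compat; auto]. }
        lra.
Qed.

Definition weight (x s t : R) : R := cos (s * sqrt (x ^ 2 + t ^ 2)) / sqrt (x ^ 2 + t ^ 2).

Lemma ex_derive_weight (x s t : R) : 0 < x -> ex_derive (weight x s) t.
Proof.
  intros Hx; unfold weight.
  assert (0 < x ^ 2 + t ^ 2) by (generalize (pow2_ge_0 t); nra).
  assert (H0 := sqrt_lt_R0 _ H).
  auto_derive; simpl in *; repeat split; lra.
Qed.

Lemma Rabs_weight_le (x s t d : R) : 0 < d -> d <= sqrt (x ^ 2 + t ^ 2) ->
  Rabs (weight x s t) <= / d.
Proof.
  intros Hd H; unfold weight, Rdiv.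
  rewrite Rabs_mult, <- (Rmult_1_l (/ d)).
  apply Rmult_le_compat; try apply Rabs_pos; [apply Rabs_cos_le_1|].
  rewrite Rabs_pos_eq by (left; apply Rinv_0_lt_compat; lra).
  apply Rinv_le_contravar; auto.
Qed.

(** Not uniform as [x] tends to 0; it is used only to show that the moments converge, never in an
    error constant. *)
Lemma Rabs_weight_x (x s t : R) : 0 < x -> Rabs (weight x s t) <= / x.
Proof.
  intros Hx; apply Rabs_weight_le; auto.
  rewrite <- (sqrt_pow2 x) at 1 by lra; apply sqrt_le_1_alt.
  generalize (pow2_ge_0 t); lra.
Qed.

(** Uniform in [x]: one power of [t] pays for the singular denominator. The error constants of the
    Laplace expansion depend on this. *)
Lemma Rabs_weight_t (x s t : R) : 0 <= t -> Rabs (t * weight x s t) <= 1.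
Proof.
  intros [Ht|Ht]; [|rewrite <- Ht, Rmult_0_l, Rabs_R0; lra].
  rewrite Rabs_mult, (Rabs_pos_eq t) by lra.
  rewrite <- (Rinv_r t) by lra; apply Rmult_le_compat_l; [lra|].
  apply Rabs_weight_le; auto.
  rewrite <- (sqrt_pow2 t) at 1 by lra; apply sqrt_le_1_alt.
  generalize (pow2_ge_0 x); lra.
Qed.

(** Put t = x sinh u. Then sqrt(x^2 + t^2) = x cosh u is also dt/du, r sinh(u)^2 = t^2/(4M), and the
    corner is sent to t = 2Mc. *)
Lemma laplace_substitution (r x s c : R) : 0 < r -> 0 < x ->
  let M := x ^ 2 / (4 * r) in
  RInt (fun u => exp (r / 2 * cosh (2 * u) - x * c * sinh u) * cos (x * s * cosh u))
    0 (arcsinh (x * c / (2 * r)))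
  = exp (r / 2) * RInt (fun t => exp (t ^ 2 / (4 * M)) * (exp (- (c * t)) * weight x s t))
      0 (2 * M * c).
Proof.
  intros Hr Hx M.
  set (f := fun t => exp (t ^ 2 / (4 * M)) * (exp (- (c * t)) * weight x s t)).
  assert (Hf : forall t, ex_derive f t).
  { intros t; unfold f; apply (ex_derive_mult (fun t => exp (t ^ 2 / (4 * M)))
      (fun t => exp (- (c * t)) * weight x s t)).
    - auto_derive; auto.
    - apply (ex_derive_mult (fun t => exp (- (c * t))) (weight x s)).
      + auto_derive; auto.
      + apply ex_derive_weight; auto. }
  assert (H : is_RInt (fun u => scal (x * cosh u) (f (x * sinh u)))
                0 (arcsinh (x * c / (2 * r)))
                (RInt f (x * sinh 0) (x * sinh (arcsinh (x * c / (2 * r)))))).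
  { apply (is_RInt_comp f (fun u => x * sinh u) (fun u => x * cosh u)).
    - intros u _; apply (ex_derive_continuous f), Hf.
    - intros u _; split.
      + apply (is_derive_scal sinh), is_derive_sinh.
      + apply (ex_derive_continuous (fun u => x * cosh u)).
        eexists; apply (is_derive_scal cosh), is_derive_cosh. }
  rewrite sinh_0, sinh_arcsinh, Rmult_0_r in H.
  replace (x * (x * c / (2 * r))) with (2 * M * c) in H by (unfold M; field; lra).
  apply (is_RInt_scal (V := R_NormedModule) _ _ _ (exp (r / 2))) in H.
  apply (is_RInt_unique (V := R_CompleteNormedModule)) in H.
  eapply eq_trans; [|exact H].
  apply RInt_ext; intros u _.
  match goal with |- _ = scal ?a (scal ?b ?c) => change (scal a (scal b c)) with (a * (b * c)) end.
  unfold f, weight.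
  assert (HC := cosh_ge_1 u); assert (E := cosh2_sinh2 u).
  replace (x ^ 2 + (x * sinh u) ^ 2) with ((x * cosh u) ^ 2)
    by (rewrite !Rpow_mult_distr; replace (cosh u ^ 2) with (1 + sinh u ^ 2) by lra; ring).
  rewrite sqrt_pow2 by nra.
  replace (r / 2 * cosh (2 * u) - x * c * sinh u) with
    (r / 2 + (x * sinh u) ^ 2 / (4 * M) + - (c * (x * sinh u)))
    by (rewrite cosh_double; unfold M; field; lra).
  rewrite !exp_plus; replace (x * s * cosh u) with (s * (x * cosh u)) by ring.
  match goal with |- @eq _ ?a ?b => change (@eq R a b) end; field; lra.
Qed.

Definition laplace_moment (k : nat) (x s c t : R) : R :=
  t ^ (2 * k) * exp (- (c * t)) * weight x s t.

Lemma ex_derive_laplace_moment (k : nat) (x s c t : R) : 0 < x ->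
  ex_derive (laplace_moment k x s c) t.
Proof.
  intros Hx; unfold laplace_moment.
  apply (ex_derive_mult (fun t => t ^ (2 * k) * exp (- (c * t))) (weight x s)).
  - auto_derive; auto.
  - apply ex_derive_weight; auto.
Qed.

Lemma is_derive_RInt_laplace_moment (k : nat) (x s c t : R) : 0 < x ->
  is_derive (fun T => RInt (laplace_moment k x s c) 0 T) t (laplace_moment k x s c t).
Proof.
  intros Hx; apply is_derive_RInt_upper; intros u.
  apply (ex_derive_continuous (laplace_moment k x s c)), ex_derive_laplace_moment; auto.
Qed.

Lemma is_derive_exp_primitive (A b t : R) : 0 < b ->
  is_derive (fun t => - (A / b) * exp (- (b * t))) t (A * exp (- (b * t))).
Proof. intros Hb; auto_derive; auto; field; lra. Qed.

Lemma is_lim_RInt_laplace_moment (k : nat) (x s c : R) : 0 < x -> 0 < c ->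
  is_lim (fun T => RInt (laplace_moment k x s c) 0 T) p_infty
    (RInt_gen (laplace_moment k x s c) (at_point 0) (Rbar_locally p_infty)).
Proof.
  intros Hx Hc.
  set (A := / x * ((/ (c / 2)) ^ (2 * k) * INR (fact (2 * k)))).
  destruct (lim_dominated (fun T => RInt (laplace_moment k x s c) 0 T)
    (fun t => - (A / (c / 2)) * exp (- (c / 2 * t)))
    (laplace_moment k x s c) (fun t => A * exp (- (c / 2 * t))) 0 0) as [l [Hl _]].
  - intros t _; apply is_derive_RInt_laplace_moment; auto.
  - intros t _; apply is_derive_exp_primitive; lra.
  - intros t Ht; unfold laplace_moment.
    assert (Hp := pow_le t (2 * k) Ht).
    rewrite !Rabs_mult, (Rabs_pos_eq (t ^ _)) by auto.
    rewrite (Rabs_pos_eq (exp _)) by (left; apply exp_pos).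
    assert (He := exp_pos (- (c * t))).
    apply Rle_trans with
      ((/ (c / 2)) ^ (2 * k) * INR (fact (2 * k)) * exp (c / 2 * t) * exp (- (c * t)) * / x).
    + apply Rmult_le_compat; [apply Rmult_le_pos; lra | apply Rabs_pos | |
        apply Rabs_weight_x; auto].
      apply Rmult_le_compat_r; [lra|]; apply pow_le_exp; lra.
    + unfold A; right.
      replace (- (c / 2 * t)) with (c / 2 * t + - (c * t)) by field.
      rewrite exp_plus; ring.
  - apply is_lim_exp_opp; lra.
  - assert (H : is_RInt_gen (laplace_moment k x s c) (at_point 0) (Rbar_locally p_infty)
                  (l - RInt (laplace_moment k x s c) 0 0)).
    { apply (is_RInt_gen_primitive _ _ _ (fun T => RInt (laplace_moment k x s c) 0 T)).
      - apply filter_forall; intros ab t _; split.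
        + apply is_derive_RInt_laplace_moment; auto.
        + apply (ex_derive_continuous (laplace_moment k x s c)).
          apply ex_derive_laplace_moment; auto.
      - intros P HP; exact (locally_singleton _ _ HP).
      - exact Hl. }
    rewrite (is_RInt_gen_unique _ _ H), RInt_point.
    unfold zero; simpl; rewrite Rminus_0_r; exact Hl.
Qed.

Lemma laplace_moment_tail (k : nat) (x s c T A b : R) :
  0 < x -> 0 < c -> 0 <= T -> 0 <= A -> 0 < b ->
  (forall t, T <= t -> Rabs (laplace_moment k x s c t) <= A * exp (- (b * t))) ->
  Rabs (RInt_gen (laplace_moment k x s c) (at_point 0) (Rbar_locally p_infty)
        - RInt (laplace_moment k x s c) 0 T) <= A / b.
Proof.
  intros Hx Hc HT HA Hb Hle.
  destruct (lim_dominated (fun T => RInt (laplace_moment k x s c) 0 T)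
    (fun t => - (A / b) * exp (- (b * t)))
    (laplace_moment k x s c) (fun t => A * exp (- (b * t))) T 0) as [l [Hl Hb']].
  - intros t _; apply is_derive_RInt_laplace_moment; auto.
  - intros t _; apply is_derive_exp_primitive; auto.
  - apply Hle.
  - apply is_lim_exp_opp; auto.
  - assert (E : Finite l = RInt_gen (laplace_moment k x s c) (at_point 0) (Rbar_locally p_infty)).
    { rewrite <- (is_lim_unique _ _ _ Hl); apply is_lim_unique.
      apply is_lim_RInt_laplace_moment; auto. }
    injection E as E; rewrite <- E.
    apply Rle_trans with (1 := Hb').
    assert (exp (- (b * T)) <= 1) by (rewrite <- exp_0; apply exp_le_compat; nra).
    assert (0 <= A / b) by (apply Rmult_le_pos; [|left; apply Rinv_0_lt_compat]; auto).
    nra.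
Qed.

Lemma Rabs_pow_weight_le (j : nat) (x s b t : R) : 0 < b -> 0 <= t ->
  t ^ S j * Rabs (weight x s t) <= (/ b) ^ j * INR (fact j) * exp (b * t).
Proof.
  intros Hb Ht.
  apply Rle_trans with (t ^ j * 1).
  - replace (t ^ S j * Rabs (weight x s t)) with (t ^ j * Rabs (t * weight x s t))
      by (rewrite Rabs_mult, (Rabs_pos_eq t) by auto; simpl; ring).
    apply Rmult_le_compat_l; [apply pow_le; auto | apply Rabs_weight_t; auto].
  - rewrite Rmult_1_r; apply pow_le_exp; auto.
Qed.

(** Beyond [2 M c] one has M <= t/(2c), so the missing N + 1 - k negative powers of [M] are bought
    with powers of [t], which the exponential absorbs. *)
Lemma laplace_tail_le (N k : nat) (c : R) : 0 < c -> (k <= N)%nat ->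
  exists K, 0 <= K /\ forall x s M, 0 < x -> 0 < M ->
  Rabs (/ M ^ k / (2 ^ (2 * k) * INR (fact k))
        * (RInt_gen (laplace_moment k x s c) (at_point 0) (Rbar_locally p_infty)
           - RInt (laplace_moment k x s c) 0 (2 * M * c)))
  <= K * / M ^ S N.
Proof.
  intros Hc Hk.
  set (j := (N - k)%nat).
  (* The first factor comes from M <= t/(2c); the rest bounds t^(2k+j) by half of the decay rate
     [c], one power of [t] having gone into the weight. *)
  set (P := (/ (2 * c)) ^ S j * ((/ (c / 2)) ^ (2 * k + j) * INR (fact (2 * k + j)))).
  assert (Hq : 0 < / (2 ^ (2 * k) * INR (fact k))).
  { apply Rinv_0_lt_compat, Rmult_lt_0_compat; [apply pow_lt; lra | apply INR_fact_lt_0]. }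
  assert (HP : 0 <= P).
  { assert (0 < / (2 * c)) by (apply Rinv_0_lt_compat; lra).
    assert (0 < / (c / 2)) by (apply Rinv_0_lt_compat; lra).
    apply Rmult_le_pos; [apply pow_le; lra|].
    apply Rmult_le_pos; [apply pow_le; lra | apply pos_INR]. }
  exists (/ (2 ^ (2 * k) * INR (fact k)) * (P / (c / 2))); split.
  - apply Rmult_le_pos; [lra|]; apply Rmult_le_pos; auto.
    left; apply Rinv_0_lt_compat; lra.
  - intros x s M Hx HM.
    assert (HMk : 0 < M ^ k) by (apply pow_lt; auto).
    assert (HMj : 0 < M ^ S j) by (apply pow_lt; auto).
    assert (EM : M ^ S N = M ^ k * M ^ S j)
      by (rewrite <- pow_add; f_equal; unfold j; lia).
    assert (HA : 0 <= P / M ^ S j)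
      by (apply Rmult_le_pos; [auto | left; apply Rinv_0_lt_compat; auto]).
    assert (H : Rabs (RInt_gen (laplace_moment k x s c) (at_point 0) (Rbar_locally p_infty)
              - RInt (laplace_moment k x s c) 0 (2 * M * c)) <= (P / M ^ S j) / (c / 2)).
    { apply laplace_moment_tail; auto; try nra.
      intros t Ht; assert (Ht0 : 0 < t) by nra.
      apply Rmult_le_reg_l with (M ^ S j); auto.
      replace (M ^ S j * (P / M ^ S j * exp (- (c / 2 * t)))) with
        ((/ (2 * c)) ^ S j * ((/ (c / 2)) ^ (2 * k + j) * INR (fact (2 * k + j))
           * exp (c / 2 * t)) * exp (- (c * t))).
      2:{ replace (exp (- (c / 2 * t))) with (exp (c / 2 * t) * exp (- (c * t)))
            by (rewrite <- exp_plus; f_equal; field).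
          transitivity (P * (exp (c / 2 * t) * exp (- (c * t)))); [unfold P; ring|].
          field; lra. }
      unfold laplace_moment; rewrite !Rabs_mult.
      rewrite (Rabs_pos_eq (t ^ _)) by (apply pow_le; lra).
      rewrite (Rabs_pos_eq (exp _)) by (left; apply exp_pos).
      assert (HMt : M ^ S j <= (/ (2 * c)) ^ S j * t ^ S j).
      { rewrite <- Rpow_mult_distr; apply pow_incr; split; [lra|].
        apply Rmult_le_reg_l with (2 * c); [lra|].
        rewrite <- Rmult_assoc, Rinv_r by lra; lra. }
      apply Rle_trans with ((/ (2 * c)) ^ S j * t ^ S j *
        (t ^ (2 * k) * exp (- (c * t)) * Rabs (weight x s t))).
      + apply Rmult_le_compat_r; auto.
        apply Rmult_le_pos; [|apply Rabs_pos].
        apply Rmult_le_pos; [apply pow_le; lra | left; apply exp_pos].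
      + replace ((/ (2 * c)) ^ S j * t ^ S j *
          (t ^ (2 * k) * exp (- (c * t)) * Rabs (weight x s t))) with
          ((/ (2 * c)) ^ S j * (t ^ S (2 * k + j) * Rabs (weight x s t)) * exp (- (c * t))).
        2:{ replace (S (2 * k + j)) with (2 * k + S j)%nat by lia.
            rewrite pow_add; ring. }
        apply Rmult_le_compat_r; [left; apply exp_pos|].
        apply Rmult_le_compat_l.
        * apply pow_le; left; apply Rinv_0_lt_compat; lra.
        * apply Rabs_pow_weight_le; lra. }
    assert (Hqk : 0 <= / M ^ k / (2 ^ (2 * k) * INR (fact k)))
      by (apply Rmult_le_pos; [left; apply Rinv_0_lt_compat; auto | lra]).
    rewrite Rabs_mult, (Rabs_pos_eq _ Hqk), EM.
    apply Rle_trans with (1 := Rmult_le_compat_l _ _ _ Hqk H).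
    right; unfold Rdiv; rewrite !Rinv_mult; ring.
Qed.

Lemma Rabs_sum_n_le (a K : nat -> R) (d : R) (N : nat) :
  (forall k, (k <= N)%nat -> Rabs (a k) <= K k * d) ->
  Rabs (sum_n a N) <= sum_n K N * d.
Proof.
  induction N as [|N IH]; intros H.
  - rewrite !sum_O; apply H; auto.
  - rewrite !sum_Sn.
    change (Rabs (sum_n a N + a (S N)) <= (sum_n K N + K (S N)) * d).
    apply Rle_trans with (1 := Rabs_triang _ _).
    rewrite Rmult_plus_distr_r; apply Rplus_le_compat; auto.
Qed.

Lemma sum_n_Rmult_r (a : nat -> R) (e : R) (N : nat) :
  sum_n (fun k => a k * e) N = sum_n a N * e.
Proof. exact (sum_n_mult_r e a N). Qed.

(** The tail constants depend on [k]; finitely many are collected into a function by induction,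
    without a choice axiom. *)
Lemma bounded_choice (P : nat -> R -> Prop) (N : nat) :
  (forall k, (k <= N)%nat -> exists K, 0 <= K /\ P k K) ->
  exists K : nat -> R, forall k, (k <= N)%nat -> 0 <= K k /\ P k (K k).
Proof.
  induction N as [|N IH]; intros H.
  - destruct (H O (le_n _)) as [K HK]; exists (fun _ => K); intros k Hk.
    replace k with O by lia; auto.
  - destruct IH as [K HK]; [intros k Hk; apply H; lia|].
    destruct (H (S N) (le_n _)) as [K' HK'].
    exists (fun k => if Nat.eqb k (S N) then K' else K k); intros k Hk.
    destruct (Nat.eqb_spec k (S N)) as [E|E]; [rewrite E; auto | apply HK; lia].
Qed.

(** With z = t^2/(4M), the Taylor remainder of exp z is at most z^(N+1)/(N+1)! times exp z, and
    z^(N+1) supplies the factor M^-(N+1). *)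
Lemma laplace_main_le (N : nat) (c : R) : 0 < c ->
  exists K, 0 <= K /\ forall x s M, 0 < x -> 0 < M ->
  Rabs (RInt (fun t => exp (t ^ 2 / (4 * M)) * (exp (- (c * t)) * weight x s t)) 0 (2 * M * c)
        - sum_n (fun k => / M ^ k / (2 ^ (2 * k) * INR (fact k))
                     * RInt (laplace_moment k x s c) 0 (2 * M * c)) N)
  <= K * / M ^ S N.
Proof.
  intros Hc.
  (* Of the rate [c], one half pays for exp z, one quarter for t^(2N+1) after the weight has used
     one of the 2N + 2 powers, and one quarter remains to be integrated. *)
  set (P := (/ (c / 4)) ^ S (2 * N) * INR (fact (S (2 * N))) / (4 ^ S N * INR (fact (S N)))).
  assert (Hf := INR_fact_lt_0 (S N)).
  assert (H4 : 0 < 4 ^ S N) by (apply pow_lt; lra).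
  assert (HP : 0 <= P).
  { assert (0 < / (c / 4)) by (apply Rinv_0_lt_compat; lra).
    apply Rmult_le_pos; [apply Rmult_le_pos; [apply pow_le; lra | apply pos_INR]|].
    left; apply Rinv_0_lt_compat, Rmult_lt_0_compat; auto. }
  exists (P / (c / 4)); split.
  - apply Rmult_le_pos; auto; left; apply Rinv_0_lt_compat; lra.
  - intros x s M Hx HM.
    assert (HMN : 0 < M ^ S N) by (apply pow_lt; auto).
    set (T := 2 * M * c); assert (HT : 0 < T) by (unfold T; nra).
    assert (H1 : is_RInt (fun t => exp (t ^ 2 / (4 * M)) * (exp (- (c * t)) * weight x s t)) 0 T
      (RInt (fun t => exp (t ^ 2 / (4 * M)) * (exp (- (c * t)) * weight x s t)) 0 T)).
    { apply (RInt_correct (V := R_CompleteNormedModule)), ex_RInt_derivable; intros t.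
      apply (ex_derive_mult (fun t => exp (t ^ 2 / (4 * M)))
        (fun t => exp (- (c * t)) * weight x s t)).
      - auto_derive; auto.
      - apply (ex_derive_mult (fun t => exp (- (c * t))) (weight x s)).
        + auto_derive; auto.
        + apply ex_derive_weight; auto. }
    assert (H2 := is_RInt_sum_n
      (fun k t => / M ^ k / (2 ^ (2 * k) * INR (fact k)) * laplace_moment k x s c t)
      (fun k => / M ^ k / (2 ^ (2 * k) * INR (fact k)) * RInt (laplace_moment k x s c) 0 T)
      0 T N).
    assert (H3 : forall k, is_RInt
       (fun t => / M ^ k / (2 ^ (2 * k) * INR (fact k)) * laplace_moment k x s c t) 0 T
       (/ M ^ k / (2 ^ (2 * k) * INR (fact k)) * RInt (laplace_moment k x s c) 0 T)).
    { intros k; apply (is_RInt_scal (V := R_NormedModule) (laplace_moment k x s c)).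
      apply (RInt_correct (V := R_CompleteNormedModule)), ex_RInt_derivable; intros t.
      apply ex_derive_laplace_moment; auto. }
    specialize (H2 H3).
    assert (H5 := is_RInt_minus _ _ _ _ _ _ H1 H2).
    assert (H6 : is_RInt (fun t => P / M ^ S N * exp (- (c / 4 * t))) 0 T
      (- (P / M ^ S N / (c / 4)) * exp (- (c / 4 * T))
       - (- (P / M ^ S N / (c / 4)) * exp (- (c / 4 * 0))))).
    { apply (is_RInt_derive (fun t => - (P / M ^ S N / (c / 4)) * exp (- (c / 4 * t)))).
      - intros t _; apply is_derive_exp_primitive; lra.
      - intros t _.
        apply (ex_derive_continuous (fun t => P / M ^ S N * exp (- (c / 4 * t)))).
        auto_derive; auto. }
    assert (HK : 0 <= P / M ^ S N / (c / 4)).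
    { apply Rdiv_le_0_compat; [apply Rdiv_le_0_compat; auto | lra]. }
    apply Rle_trans with
      (- (P / M ^ S N / (c / 4)) * exp (- (c / 4 * T))
       - (- (P / M ^ S N / (c / 4)) * exp (- (c / 4 * 0)))).
    2:{ rewrite Rmult_0_r, Ropp_0, exp_0.
        generalize (exp_pos (- (c / 4 * T))); intros He.
        replace (P / (c / 4) * / M ^ S N) with (P / M ^ S N / (c / 4))
          by (unfold Rdiv; ring).
        nra. }
    refine (norm_RInt_le _ _ 0 T _ _ _ _ H5 H6); [lra|].
    intros t Ht.
    set (z := t ^ 2 / (4 * M)).
    assert (Hz : 0 <= z).
    { apply Rmult_le_pos; [apply pow2_ge_0 | left; apply Rinv_0_lt_compat; lra]. }
    (* Exactly the condition t <= 2Mc. *)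
    assert (Hzc : z <= c / 2 * t).
    { unfold z; apply Rmult_le_reg_r with (4 * M); [lra|].
      unfold Rdiv at 1; rewrite Rmult_assoc, Rinv_l by lra; unfold T in Ht; nra. }
    match goal with |- norm ?p <= _ =>
      replace p with ((exp z - sum_n (fun k => z ^ k / INR (fact k)) N)
                      * (exp (- (c * t)) * weight x s t)) end.
    2:{ match goal with |- _ = minus ?a ?b => change (minus a b) with (a - b) end.
        rewrite Rmult_minus_distr_r; f_equal.
        rewrite <- sum_n_Rmult_r; apply sum_n_ext; intros k.
        unfold laplace_moment, z.
        rewrite (pow_mult t 2 k), (pow_mult 2 2 k).
        replace (2 ^ 2) with 4 by ring.
        unfold Rdiv; rewrite (Rpow_mult_distr (t ^ 2)), pow_inv, Rpow_mult_distr.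
        rewrite !Rinv_mult.
        match goal with |- @eq _ ?a ?b => change (@eq R a b) end; ring. }
    destruct (exp_taylor_remainder N z Hz) as [HR0 HR1].
    change (Rabs ((exp z - sum_n (fun k => z ^ k / INR (fact k)) N)
                  * (exp (- (c * t)) * weight x s t)) <= P / M ^ S N * exp (- (c / 4 * t))).
    rewrite !Rabs_mult, (Rabs_pos_eq (_ - _)) by auto.
    rewrite (Rabs_pos_eq (exp _)) by (left; apply exp_pos).
    assert (Hew : 0 <= exp (- (c * t)) * Rabs (weight x s t))
      by (apply Rmult_le_pos; [left; apply exp_pos | apply Rabs_pos]).
    apply Rle_trans with
      (z ^ S N / INR (fact (S N)) * exp (c / 2 * t) * (exp (- (c * t)) * Rabs (weight x s t))).
    { apply Rmult_le_compat_r; auto.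
      apply Rle_trans with (1 := HR1).
      apply Rmult_le_compat_l; [|apply exp_le_compat; auto].
      apply Rmult_le_pos; [apply pow_le; auto | left; apply Rinv_0_lt_compat; auto]. }
    assert (Hw := Rabs_pow_weight_le (S (2 * N)) x s (c / 4) t ltac:(lra) ltac:(lra)).
    assert (Ez : z ^ S N = t ^ S (S (2 * N)) * / (4 ^ S N * M ^ S N)).
    { unfold z, Rdiv; rewrite Rpow_mult_distr, pow_inv, Rpow_mult_distr, <- pow_mult.
      do 2 f_equal; lia. }
    rewrite Ez.
    apply Rle_trans with
      ((/ (4 ^ S N * M ^ S N) / INR (fact (S N)) * exp (c / 2 * t) * exp (- (c * t)))
       * ((/ (c / 4)) ^ S (2 * N) * INR (fact (S (2 * N))) * exp (c / 4 * t))).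
    { apply Rle_trans with
        ((/ (4 ^ S N * M ^ S N) / INR (fact (S N)) * exp (c / 2 * t) * exp (- (c * t)))
         * (t ^ S (S (2 * N)) * Rabs (weight x s t))); [right; unfold Rdiv; ring|].
      apply Rmult_le_compat_l; auto.
      assert (0 < / (4 ^ S N * M ^ S N))
        by (apply Rinv_0_lt_compat, Rmult_lt_0_compat; auto).
      repeat apply Rmult_le_pos; try (left; apply exp_pos); [lra|].
      left; apply Rinv_0_lt_compat; auto. }
    right.
    replace (- (c / 4 * t)) with (c / 2 * t + - (c * t) + c / 4 * t) by field.
    rewrite !exp_plus; unfold P; field; repeat split; lra.
Qed.

Lemma laplace_remainder (N : nat) (c : R) : 0 < c ->
  exists K, 0 <= K /\ forall x s M, 0 < x -> 0 < M ->
  Rabs (RInt (fun t => exp (t ^ 2 / (4 * M)) * (exp (- (c * t)) * weight x s t)) 0 (2 * M * c)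
        - sum_n (fun k => / M ^ k / (2 ^ (2 * k) * INR (fact k))
            * RInt_gen (laplace_moment k x s c) (at_point 0) (Rbar_locally p_infty)) N)
  <= K * / M ^ S N.
Proof.
  intros Hc.
  destruct (laplace_main_le N c Hc) as [K1 [HK1 H1]].
  destruct (bounded_choice _ N (fun k Hk => laplace_tail_le N k c Hc Hk)) as [K2 HK2].
  exists (K1 + Rabs (sum_n K2 N)); split; [generalize (Rabs_pos (sum_n K2 N)); lra|].
  intros x s M Hx HM; specialize (H1 x s M Hx HM).
  set (T := 2 * M * c) in *.
  set (q := fun k => / M ^ k / (2 ^ (2 * k) * INR (fact k))) in *.
  set (I := fun k => RInt (laplace_moment k x s c) 0 T) in *.
  set (V := fun k => RInt_gen (laplace_moment k x s c) (at_point 0) (Rbar_locally p_infty)).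
  assert (H2 : Rabs (sum_n (fun k => q k * (V k - I k)) N) <= sum_n K2 N * / M ^ S N).
  { apply Rabs_sum_n_le; intros k Hk; apply (proj2 (HK2 k Hk) x s M Hx HM). }
  assert (E : sum_n (fun k => q k * V k) N
            = sum_n (fun k => q k * I k) N + sum_n (fun k => q k * (V k - I k)) N).
  { etransitivity; [|apply (sum_n_plus (G := R_AbelianMonoid))].
    apply sum_n_ext; intros k.
    match goal with |- ?a = plus ?b ?d => change (@eq R a (b + d)) end; ring. }
  change (sum_n (fun k => / M ^ k / (2 ^ (2 * k) * INR (fact k))
            * RInt_gen (laplace_moment k x s c) (at_point 0) (Rbar_locally p_infty)) N)
    with (sum_n (fun k => q k * V k) N).
  change (sum_n (fun k => / M ^ k / (2 ^ (2 * k) * INR (fact k))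
            * RInt (laplace_moment k x s c) 0 T) N)
    with (sum_n (fun k => q k * I k) N) in H1.
  rewrite E.
  match goal with |- Rabs (?a - (?b + ?d)) <= _ =>
    replace (a - (b + d)) with ((a - b) + - d) by ring end.
  apply Rle_trans with (1 := Rabs_triang _ _); rewrite Rabs_Ropp.
  assert (HMi : 0 < / M ^ S N) by (apply Rinv_0_lt_compat, pow_lt; auto).
  generalize (Rle_abs (sum_n K2 N)); nra.
Qed.

(** * The expansion *)

Lemma coefC_eq (k : nat) (x alpha : R) :
  coefC k x alpha = 2 / PI * RInt_gen
    (laplace_moment k x (sin (alpha / 2)) (cos (alpha / 2))) (at_point 0)
    (Rbar_locally p_infty).
Proof. reflexivity. Qed.

(** The prefactor combines with exp(rho sin(v)^2) because cos 2v = 1 - 2 sin(v)^2. *)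
Lemma struve_series_eq (x rho alpha : R) :
  PI * exp (- (rho / 2))
    * Series (fun r => rho ^ r / INR (fact r) * Series (struve_term x alpha r))
  = 2 * RInt (fun v => exp (- (rho / 2) * cos (2 * v))
      * (sin (x * cos (alpha / 2) * cos v) * cos (x * sin (alpha / 2) * sin v))) 0 (PI / 2).
Proof.
  rewrite (is_series_unique _ _ (is_series_struve x rho alpha)).
  set (f := fun v => exp (rho * sin v ^ 2) *
       (sin (x * cos (alpha / 2) * cos v) * cos (x * sin (alpha / 2) * sin v))).
  transitivity (2 * (exp (- (rho / 2)) * RInt f 0 (PI / 2))); [field; apply PI_neq0|].
  f_equal; symmetry.
  eapply eq_trans; [|apply (RInt_scal (V := R_CompleteNormedModule) f 0 (PI / 2)
                              (exp (- (rho / 2))))].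
  - apply RInt_ext; intros v _; unfold f.
    match goal with |- _ = scal ?a ?b => change (scal a b) with (a * b) end.
    rewrite cos_2a_sin.
    replace (- (rho / 2) * (1 - 2 * sin v * sin v)) with
      (- (rho / 2) + rho * sin v ^ 2) by field.
    rewrite exp_plus; match goal with |- @eq _ ?a ?b => change (@eq R a b) end; ring.
  - apply ex_RInt_derivable; intros v; unfold f; auto_derive; auto.
Qed.

Theorem theorem2 (B alpha : R) (n : nat)
  (hB : 0 < B) (halpha : 0 < alpha <= PI / 2) (hn : (1 <= n)%nat) :
  exists E1 E2 E3 : R -> R -> C,
    is_bigO n alpha B (fun M => / M ^ n) E1 /\
    is_bigO n alpha B (fun M => exp (- (M * cos (alpha / 2) ^ 2))) E2 /\
    is_bigO n alpha B (fun M => / sqrt M * exp (- (M * cos alpha))) E3 /\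
    forall x rho : R,
      0 < x < B -> 0 < rho < B ->
      INR n < Mpar x rho * cos (alpha / 2) ^ 2 ->
      ex_RInt_gen (V := C_R_NormedModule) (F_integrand x rho alpha)
        (Rbar_locally m_infty) (Rbar_locally p_infty) /\
      (forall r : nat, ex_series (struve_term x alpha r)) /\
      ex_series (fun r : nat =>
        rho ^ r / INR (fact r) * Series (struve_term x alpha r)) /\
      F x rho alpha =
        (RtoC (- (PI * exp (- (rho / 2))
                  * Series (fun r : nat =>
                      (rho ^ r / INR (fact r) * Series (struve_term x alpha r))%R)))
         + RtoC (PI * exp (rho / 2))
           * (RtoC (sum_n_m (fun k : nat =>
                      (/ Mpar x rho ^ k / (2 ^ (2 * k) * INR (fact k))
                      * coefC k x alpha)%R) 0 (n - 1))
              + E1 x rho)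
         + E2 x rho + E3 x rho)%C.
Proof.
  assert (HPI := PI_RGT_0).
  set (s := sin (alpha / 2)); set (c := cos (alpha / 2)).
  assert (Hc : 0 < c) by (apply cos_gt_0; lra).
  (* With [n = S N] the sum runs over k <= N, and the remainder M^-(N+1) of the Laplace expansion is
     M^-n. *)
  destruct n as [|N]; [lia|].
  replace (S N - 1)%nat with N by lia.
  destruct (laplace_remainder N c Hc) as [K [HK HL]].
  set (lap := fun x rho => RInt (fun t => exp (t ^ 2 / (4 * Mpar x rho))
                * (exp (- (c * t)) * weight x s t)) 0 (2 * Mpar x rho * c)).
  set (psum := fun x rho => sum_n (fun k => / Mpar x rho ^ k / (2 ^ (2 * k) * INR (fact k))
        * RInt_gen (laplace_moment k x s c) (at_point 0) (Rbar_locally p_infty)) N).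
  set (main := fun x rho =>
    - (2 * RInt (fun v => exp (- (rho / 2) * cos (2 * v))
             * (sin (x * c * cos v) * cos (x * s * sin v))) 0 (PI / 2))
    + 2 * RInt (fun u => exp (rho / 2 * cosh (2 * u) - x * c * sinh u)
                 * cos (x * s * cosh u)) 0 (arcsinh (x * c / (2 * rho)))).
  set (plim := fun x rho => pot_lim rho x (alpha / 2) 0 + pot_lim rho x (- (alpha / 2)) 0).
  assert (Hn0 : 0 <= INR (S N) / c ^ 2) by (apply Rdiv_le_0_compat; [apply pos_INR | nra]).
  assert (HM0 : INR (S N) / c ^ 2 < INR (S N) / c ^ 2 + 1) by lra.
  (* [E1] is the Laplace remainder, scaled by 2/PI to match [coefC]. It already contains the error
     of cutting the moments at [2 M c], so [E2] is taken to be 0. [E3] is the error of stopping at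
     the corner, that is, the contribution of the saddle curve. *)
  exists (fun x rho => RtoC (2 / PI * (lap x rho - psum x rho))), (fun _ _ => RtoC 0),
    (fun x rho => RtoC (plim x rho - main x rho)).
  split; [|split; [|split]].
  (* The summand 1 makes the constant strictly positive, since [K] is only known to be nonnegative;
     in the threshold it gives the strict inequality required of [M0]. *)
  - exists (2 / PI * K + 1), (INR (S N) / c ^ 2 + 1).
    assert (H2 : 0 < 2 / PI) by (apply Rdiv_lt_0_compat; lra).
    split; [nra|split; [exact HM0|]]; intros x rho Hx Hrho HM.
    rewrite Cmod_R, Rabs_mult, (Rabs_pos_eq (2 / PI)) by lra.
    specialize (HL x s (Mpar x rho) ltac:(lra) ltac:(lra)).
    fold (lap x rho) in HL; fold (psum x rho) in HL.
    assert (0 < / Mpar x rho ^ S N) by (apply Rinv_0_lt_compat, pow_lt; lra).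
    apply Rle_trans with (2 / PI * (K * / Mpar x rho ^ S N)); [|nra].
    apply Rmult_le_compat_l; [lra | exact HL].
  - exists 1, (INR (S N) / c ^ 2 + 1).
    split; [lra|split; [exact HM0|]]; intros x rho _ _ _.
    rewrite Cmod_R, Rabs_R0, Rmult_1_l; left; apply exp_pos.
  (* The factor exp(rho/2) of [pot_lim_sum] is bounded by exp(B/2), which makes the constant
     independent of [rho]. *)
  - exists (2 * (exp (B / 2) * PI / c)), (INR (S N) / c ^ 2 + 1).
    assert (He := exp_pos (B / 2)).
    split; [|split; [exact HM0|]].
    + apply Rmult_lt_0_compat; [lra|].
      apply Rdiv_lt_0_compat; auto; apply Rmult_lt_0_compat; auto.
    + intros x rho Hx Hrho HM; rewrite Cmod_R.
      apply Rle_trans with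
        (1 := pot_lim_sum rho x alpha ltac:(lra) ltac:(lra) halpha).
      fold (Mpar x rho); fold c.
      apply Rmult_le_compat_r.
      * apply Rmult_le_pos; left; [|apply exp_pos].
        apply Rinv_0_lt_compat, sqrt_lt_R0; lra.
      * apply Rmult_le_compat_l; [lra|].
        unfold Rdiv; apply Rmult_le_compat_r; [left; apply Rinv_0_lt_compat; auto|].
        apply Rmult_le_compat_r; [lra|]; apply exp_le_compat; lra.
  - intros x rho Hx Hrho _; split; [|split; [|split]].
    + eexists; apply is_RInt_gen_F; auto; lra.
    + intros r; eexists; apply is_series_struve_term.
    + eexists; apply is_series_struve.
    + rewrite F_eq by (auto; lra).
      rewrite struve_series_eq; fold s c.
      replace (sum_n_m _ 0 N) with (2 / PI * psum x rho).
      * rewrite <- !RtoC_plus, <- RtoC_mult, <- !RtoC_plus; f_equal.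
        fold (plim x rho); unfold main.
        rewrite (laplace_substitution rho x s c) by lra.
        fold (Mpar x rho); fold (lap x rho); field; lra.
      * unfold psum; rewrite Rmult_comm, <- sum_n_Rmult_r.
        apply sum_n_ext; intros k; rewrite coefC_eq; fold s c.
        match goal with |- @eq _ ?a ?b => change (@eq R a b) end; ring.
Qed.
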